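(* There are absolute constants $\varepsilon_{\max},\gamma_{\max},\delta_{\max}>0$ and $q_{\min}$ such that for all $n\ge2$, $q\ge q_{\min}$, $\varepsilon<\varepsilon_{\max}$, $\gamma<\gamma_{\max}$, $\delta\le\delta_{\max}$ the following hold. Here ''solving problem $P$ requires cost $\Omega(C)$ on instance $\mu$'' means: every algorithm which solves $P$ with failure probability at most $\gamma$ on every instance has expected number of oracle calls $\Omega(C)$ on $\mu$ (absolute constant in $\Omega$). (a) There is an instance $\mu$ in the integer setting with the given $n$ and log partition ratio $q$ on which solving $\tilde P^{\delta,\varepsilon}_{\mathrm{count}}$ or $P^{\delta,\varepsilon}_{\mathrm{count}}$ requires cost $\Omega\bigl(\frac{\min\{q+\sqrt q/\delta,\ n^2+n/\delta\}\log\frac1\gamma}{\varepsilon^2}\bigr)$. (b) There is a log-concave instance with the given $n$ and $q$ on which solving $\tilde P^{\delta,\varepsilon}_{\mathrm{count}}$ or $P^{\delta,\varepsilon}_{\mathrm{count}}$ requires cost $\Omega\bigl(\frac{(1/\delta+\min\{q,n^2\})\log\frac1\gamma}{\varepsilon^2}\bigr)$. (c) There is a log-concave instance with the given $n$ and $q$ on which solving $P_{\mathrm{ratio}}$ requires cost $\Omega\bigl(\frac{\min\{q,n^2\}\log\frac1\gamma}{\varepsilon^2}\bigr)$. (d) There is an instance with the given $n$ and $q$ on which solving $\tilde P^{\delta,\varepsilon}_{\mathrm{count}}$ or $P^{\delta,\varepsilon}_{\mathrm{count}}$ requires cost $\Omega\bigl(\frac{(q+\sqrt q/\delta)\log\frac1\gamma}{\varepsilon^2}\bigr)$.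 (e) There is an instance with the given $n$ and $q$ on which solving $P_{\mathrm{ratio}}$ requires cost $\Omega\bigl(\frac{q\log\frac1\gamma}{\varepsilon^2}\bigr)$.
   Context: Setup. Let $\mathcal F=\{0\}\cup[1,n]$. An instance consists of nonnegative counts $c_x$ ($x\in\mathcal F$), finitely many nonzero and not all zero, and reals $\beta_{\min}<\beta_{\max}$. Let $Z(\beta)=\sum_xc_xe^{\beta x}$, $\mu_\beta(x)=c_xe^{\beta x}/Z(\beta)$, $Q(\beta)=Z(\beta)/Z(\beta_{\min})$, log partition ratio $q=\log Q(\beta_{\max})$, $\pi(x)=\mu_{\beta_{\min}}(x)$, $\Delta(x)=\max_{\beta\in[\beta_{\min},\beta_{\max}]}\mu_\beta(x)$. An algorithm accesses the instance only via an oracle which, on query $\beta\in[\beta_{\min},\beta_{\max}]$ (chosen adaptively, possibly at random), returns an independent sample from $\mu_\beta$. Integer setting: $n$ integer and $c_x=0$ for $x\notin\{0,\dots,n\}$. Log-concave: integer setting where the indices $k$ with $c_k\ne0$ form a discrete interval $\{i_0,\dots,i_1\}$ and $c_k^2\ge c_{k-1}c_{k+1}$ for $i_0<k<i_1$. Problems (each to be solved with probability at least $1-\gamma$): $P_{\mathrm{ratio}}$: output $\hat Q$ with $|\log\hat Q-\log Q(\beta_{\max})|\le\varepsilon$. $P^{\delta,\varepsilon}_{\mathrm{count}}$: output vectors $\hat\pi,u$ on $\mathcal F$ with (i) $|\hat\pi(x)-\pi(x)|\le u(x)\le\varepsilon\pi(x)(1+\delta/\Delta(x))$ for all $x$ with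 $c_x\ne0$ and (ii) $\hat\pi(x)=0$ whenever $c_x=0$. $\tilde P^{\delta,\varepsilon}_{\mathrm{count}}$: output a vector $\hat c\in(\mathbb R_{>0}\cup\{?\})^{\mathcal F}$ with (i) $|\log(\hat c_x/\hat c_y)-\log(c_x/c_y)|\le\varepsilon$ for all $x,y$ with $\hat c_x,\hat c_y\ne\,?$, and (ii) $\hat c_x\ne\,?$ for every $x$ with $\Delta(x)\ge\delta$. *)

(* Defs.v *)
(* MathComp world (MathComp-Analysis). *)
From HB Require Import structures.
From mathcomp Require Import all_boot all_order all_algebra.
From mathcomp Require Import all_classical all_reals all_analysis.

Set Implicit Arguments.
Unset Strict Implicit.
Unset Printing Implicit Defensive.

Import Order.TTheory GRing.Theory Num.Theory.
Import numFieldNormedType.Exports.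

Local Open Scope classical_set_scope.
Local Open Scope ring_scope.

Definition ground (R : realType) (n : R) : set R := [set 0] `|` `[1, n].

Record instance (R : realType) (n : R) := Instance {
  count : R -> R ;
  bmin : R ;
  bmax : R ;
  count_ge0 : forall x, 0 <= count x ;
  count_ground : forall x, count x != 0 -> ground n x ;
  count_finite : finite_set [set x | count x != 0] ;
  count_neq0 : exists x, count x != 0 ;
  bmin_lt_bmax : bmin < bmax }.

Section Gibbs.
Context {R : realType} {n : R}.
Variable I : instance n.

(* The sum has finite support because [count I] does. *)
Definition partition_fun (b : R) : R :=
  \sum_(x \in ground n) count I x * expR (b * x).

Definition gibbs (b x : R) : R := count I x * expR (b * x) / partition_fun b.

Definition part_ratio (b : R) : R := partition_fun b / partition_fun (bmin I).

Definition log_ratio : R := ln (part_ratio (bmax I)).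

Definition gibbs_min (x : R) : R := gibbs (bmin I) x.

(* The supremum is attained: [gibbs b x] is continuous in [b] and the interval
   is compact. *)
Definition Delta (x : R) : R := sup [set gibbs b x | b in `[bmin I, bmax I]].

Definition integer_setting : Prop :=
  n \is a Num.int /\
  forall x, ~ (exists2 k : nat, k%:R <= n & x = k%:R) -> count I x = 0.

Definition log_concave : Prop :=
  integer_setting /\
  exists i0 i1 : nat,
    (forall k : nat, count I k%:R != 0 <-> (i0 <= k <= i1)%N) /\
    (forall k : nat, (i0 < k < i1)%N ->
       count I k.-1%:R * count I k.+1%:R <= count I k%:R ^+ 2).

End Gibbs.

(* A randomized adaptive algorithm is a deterministic decision procedure
   applied to a random seed, drawn from an arbitrary probability space.  Given
   the seed [w] and the list [s] of samples received so far, oldest first,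
   [next w s] is either [inl b] (query the oracle at [b]) or [inr o] (halt with
   output [o]).  Decisions to query are random variables; nothing is required of
   the way outputs depend on the seed. *)
Record strategy (R : realType) (Out : Type) (b0 b1 : R) := Strategy {
  seed_display : measure_display ;
  seed : measurableType seed_display ;
  seed_law : probability seed R ;
  next : seed -> seq R -> R + Out ;
  next_range : forall w s b, next w s = inl b -> b0 <= b <= b1 ;
  next_measurable : forall (s : seq R) (B : set R), measurable B ->
    measurable [set w | exists2 b, B b & next w s = inl b] }.

Arguments next {R Out b0 b1} _ _ _.

(* The inverse temperatures are known to the algorithm, the counts are not. *)
Definition algorithm (R : realType) (Out : Type) :=
  forall b0 b1 : R, strategy Out b0 b1.

Section Run.
Context {R : realType} {n : R} {Out : Type}.

(* Probability, for a fixed seed, that the run makes at least [size s] oracle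
   calls and that the first [size s] answers are [s], each being drawn from the
   Gibbs distribution at the queried point independently of the past. *)
Definition history_prob (I : instance n) (f : seq R -> R + Out) (s : seq R) : R :=
  \prod_(i < size s) (if f (take i s) is inl b then gibbs I b s`_i else 0).

(* The number of calls is the number of histories traversed by the run at which
   the algorithm queries.  A run that never halts makes infinitely many. *)
Definition expected_calls (A : algorithm R Out) (I : instance n) : \bar R :=
  let S := A (bmin I) (bmax I) in
  (\int[seed_law S]_w
     \esum_(s in [set s | exists b, next S w s = inl b])
        (history_prob I (next S w) s)%:E)%E.

(* If halting in [E] is not measurable in the seed, the integral is a lower
   integral and this is the inner probability. *)
Definition output_prob (A : algorithm R Out) (I : instance n) (E : set Out) :
    \bar R :=
  let S := A (bmin I) (bmax I) in
  (\int[seed_law S]_w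
     \esum_(s in [set s | exists2 o, E o & next S w s = inr o])
        (history_prob I (next S w) s)%:E)%E.

(* A problem [P] gives the set [P I] of correct outputs on each instance. *)
Definition solves (P : instance n -> set Out) (g : R) (A : algorithm R Out) :
    Prop :=
  forall I : instance n, ((1 - g)%:E <= output_prob A I (P I))%E.

Definition requires_cost (P : instance n -> set Out) (g : R) (I : instance n)
    (C : R) : Prop :=
  forall A : algorithm R Out, solves P g A -> (C%:E <= expected_calls A I)%E.

End Run.

Section Problems.
Context {R : realType} {n : R}.

(* [ln] is 0 on nonpositive reals, hence the explicit positivity. *)
Definition P_ratio (e : R) (I : instance n) : set R :=
  [set Qh | 0 < Qh /\ `|ln Qh - ln (part_ratio I (bmax I))| <= e].

(* Only the values on [ground n] of the output vectors matter. *)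
Definition P_count (d e : R) (I : instance n) : set ((R -> R) * (R -> R)) :=
  [set o | let: (pih, u) := o in
     (forall x, count I x != 0 ->
        `|pih x - gibbs_min I x| <= u x /\
        u x <= e * gibbs_min I x * (1 + d / Delta I x)) /\
     (forall x, ground n x -> count I x = 0 -> pih x = 0)].

(* [None] stands for the symbol ?.  For a zero count the logarithm in (i) is
   not a real number, and (i) is then violated: an estimate may only be given
   at [x] when [count I x] is positive. *)
Definition Pt_count (d e : R) (I : instance n) : set (R -> option {posnum R}) :=
  [set ch |
     (forall x y a b, ground n x -> ground n y ->
        ch x = Some a -> ch y = Some b ->
        [/\ 0 < count I x, 0 < count I y &
            `|ln (a%:num / b%:num) - ln (count I x / count I y)| <= e]) /\
     (forall x, ground n x -> d <= Delta I x -> ch x <> None)].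

End Problems.

(* Main.v *)
Require Import Defs.
From HB Require Import structures.
From mathcomp Require Import all_boot all_order all_algebra.
From mathcomp Require Import all_classical all_reals all_analysis.
From mathcomp Require Import measurable_realfun finmap ring lra.

Set Implicit Arguments.
Unset Strict Implicit.
Unset Printing Implicit Defensive.

Import Order.TTheory GRing.Theory Num.Theory.
Import numFieldNormedType.Exports.

Local Open Scope classical_set_scope.
Local Open Scope ring_scope.

(* Change of measure.  Suppose the correct outputs on [I0] are incorrect on each
   of the instances [I j], and that along any query the sum over [j] of the
   log-likelihood ratios of [I j] against [I0] is at least [- #|J| * kappa].  On
   a history with [t] calls, the average over [j] of the probabilities under
   [I j] is then at least [expR (- kappa * t)] times the probability under [I0].
   An algorithm with failure probability [gamma] must therefore make of order
   [ln (1 / gamma) / kappa] calls on [I0].  The counts of the instances [I j]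
   are those of [I0] times [expR h] and [expR (- h)]: first order terms in [h]
   cancel within a pair, and [kappa] is quadratic in [h].

   For the terms [q] and [n ^+ 2], [I0] has the counts [expR (- 3 k ^+ 2)] at
   [m] equally spaced points and [h] is linear in [k], of total variation of
   order [eps]; since all Gibbs distributions have bounded variance in [k],
   [kappa] is of order [(eps / m) ^+ 2].  For the terms divided by [delta], [m]
   light atoms are inserted between the atoms of the discrete Gaussian; each has
   probability at least [delta] at some temperature, while together they have
   probability [O(delta)] at every temperature, so that perturbing them one at a
   time by a factor [expR (12 * eps)] or its inverse gives [kappa] of order
   [delta * eps ^+ 2 / m].  Two atoms suffice for the term [1 / delta]. *)

(** * Histories of a run *)

Section GibbsLaw.
Context {R : realType} {n : R}.
Variable I : instance n.

Definition supp := fset_set [set x | Defs.count I x != 0].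

Lemma in_supp x : (x \in supp) = (Defs.count I x != 0).
Proof.
rewrite in_fset_set; last exact: count_finite.
by apply/idP/idP => [/set_mem//|cx]; exact/mem_set.
Qed.

Lemma partition_funE b : partition_fun I b = \sum_(x <- supp) Defs.count I x *
  expR (b * x).
Proof.
rewrite /partition_fun /supp.
rewrite -fsbig_finite; last exact: count_finite.
apply: esym; apply: fsbig_widen.
  by move=> x /= cx; exact: (@count_ground _ _ I).
by move=> x /= [_ /negP]; rewrite negbK => /eqP ->; rewrite mul0r.
Qed.

Lemma partition_fun_gt0 b : 0 < partition_fun I b.
Proof.
have [x cx] := count_neq0 I.
rewrite partition_funE (big_fsetD1 x) ?in_supp//=.
rewrite ltr_pwDl//.
  by rewrite mulr_gt0 ?expR_gt0// lt_neqAle eq_sym cx count_ge0.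
by apply: sumr_ge0 => i _; rewrite mulr_ge0 ?expR_ge0 ?count_ge0.
Qed.

Lemma gibbs_ge0 b x : 0 <= gibbs I b x.
Proof.
by rewrite divr_ge0 ?mulr_ge0 ?expR_ge0 ?count_ge0// ltW// partition_fun_gt0.
Qed.

Lemma gibbs_eq0 b x : x \notin supp -> gibbs I b x = 0.
Proof. by rewrite in_supp negbK /gibbs => /eqP ->; rewrite !mul0r. Qed.

Lemma sum_gibbs b : \sum_(x <- supp) gibbs I b x = 1.
Proof.
by rewrite -mulr_suml -partition_funE divff// gt_eqF// partition_fun_gt0.
Qed.

End GibbsLaw.

Section Histories.
Context {R : realType} {n : R} {Out : Type}.
Variables (I : instance n) (f : seq R -> R + Out).

Local Notation hp := (history_prob I f).

Definition halts (s : seq R) : bool := if f s is inl _ then false else true.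

Lemma history_prob_nil : hp [::] = 1.
Proof. by rewrite /history_prob big_ord0. Qed.

Lemma history_prob_rcons s x :
  hp (rcons s x) = hp s * (if f s is inl b then gibbs I b x else 0).
Proof.
rewrite /history_prob size_rcons big_ord_recr /=; congr (_ * _); last first.
  by rewrite -cats1 take_size_cat// nth_cat ltnn subnn.
apply: eq_bigr => i _; rewrite -cats1 take_cat ltn_ord nth_cat ltn_ord.
by rewrite /=.
Qed.

Lemma history_prob_ge0 s : 0 <= hp s.
Proof. by apply: prodr_ge0 => i _; case: (f _) => // b; exact: gibbs_ge0. Qed.

(** Every history of positive probability is in one of these finite lists, so sums over histories of
    a given length are finite. Words grow at the right end because [history_prob] factors off its
    last answer. *)
Fixpoint words (k : nat) : seq (seq R) :=
  if k is k'.+1 then [seq rcons s x | s <- words k', x <- supp I]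
  else [:: [::]].

Lemma size_words k s : s \in words k -> size s = k.
Proof.
elim: k s => [|k IH] s /=; first by rewrite inE => /eqP ->.
by move=> /allpairsP[[t x] /= [ht _ ->]]; rewrite size_rcons IH.
Qed.

Lemma words_uniq k : uniq (words k).
Proof.
elim: k => //= k IH; apply: allpairs_uniq => //; first exact: fset_uniq.
by move=> [s x] [t y] _ _ /= /rcons_inj [-> ->].
Qed.

Lemma mem_words s : hp s != 0 -> s \in words (size s).
Proof.
elim/last_ind: s => [|s x IH]; first by rewrite inE.
rewrite history_prob_rcons size_rcons mulf_eq0 negb_or => /andP[/IH hs hx].
apply/allpairsP; exists (s, x); split=> //=.
by apply: contraNT hx => hx; case: (f s) => // b; rewrite gibbs_eq0.
Qed.

(** After a query the Gibbs probabilities of the answers sum to 1; after a halt every extension has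
    probability 0. *)
Lemma sum_words_rcons k :
  \sum_(s <- words k.+1) hp s = \sum_(s <- words k | ~~ halts s) hp s.
Proof.
rewrite /= big_allpairs_dep /= big_mkcond [RHS]big_mkcond; apply: eq_bigr => s _.
under eq_bigr do rewrite history_prob_rcons.
rewrite -mulr_sumr /halts; case: (f s) => [b|o] /=.
  by rewrite sum_gibbs mulr1.
by rewrite big1 ?mulr0.
Qed.

Definition halt_mass k : R := \sum_(s <- words k | halts s) hp s.
Definition query_mass k : R := \sum_(s <- words k | ~~ halts s) hp s.

Lemma halt_mass_ge0 k : 0 <= halt_mass k.
Proof. by apply: sumr_ge0 => s _; exact: history_prob_ge0. Qed.

Lemma query_mass_ge0 k : 0 <= query_mass k.
Proof. by apply: sumr_ge0 => s _; exact: history_prob_ge0. Qed.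

Lemma halt_mass_query_mass k :
  halt_mass k + query_mass k = \sum_(s <- words k) hp s.
Proof. by rewrite [RHS](bigID halts). Qed.

(** The run either halts after at most [k] answers or makes one more query: conservation of mass, by
    induction on [k]. *)
Lemma halt_query_mass k : \sum_(i < k.+1) halt_mass i + query_mass k = 1.
Proof.
elim: k => [|k IH].
  by rewrite big_ord1 halt_mass_query_mass /= big_seq1 history_prob_nil.
rewrite big_ord_recr /= -addrA.
by rewrite halt_mass_query_mass sum_words_rcons.
Qed.

Lemma sum_halt_mass_le1 k : \sum_(i < k) halt_mass i <= 1.
Proof.
case: k => [|k]; first by rewrite big_ord0.
by rewrite -(halt_query_mass k) lerDl query_mass_ge0.
Qed.

(** A run that halts after more than [k] answers must still be querying after [k] of them. Formally,
    both sides are compared through the total mass 1. *)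
Lemma late_halt_mass k m N : (k < m)%N ->
  \sum_(m <= i < N) halt_mass i <= query_mass k.
Proof.
move=> km; have [Nm|mN] := leqP N m; first by rewrite big_geq// query_mass_ge0.
have := sum_halt_mass_le1 N; rewrite -{1}(halt_query_mass k).
rewrite -[X in X <= _ -> _](big_mkord xpredT) (big_cat_nat (n := k.+1)) //=;
  last first.
  by rewrite (leq_trans km)// ltnW.
rewrite big_mkord lerD2l; apply: le_trans.
rewrite [leRHS](big_cat_nat (n := m)) //=; last by rewrite ltnW.
by rewrite lerDr sumr_ge0// => i _; exact: halt_mass_ge0.
Qed.

(** An [esum] is a supremum over finite subsets, and the lengths in a finite set of histories are
    bounded. Such a set is thus covered by the halting words of lengths from [m] to some [N]. *)
Lemma esum_halts_le (A : set (seq R)) m (c : R) :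
  (forall s, A s -> halts s /\ (m <= size s)%N) ->
  (forall N, \sum_(m <= i < N) halt_mass i <= c) ->
  (\esum_(s in A) (hp s)%:E <= c%:E)%E.
Proof.
move=> hA hc; apply: ge_ereal_sup => _ [X [finX XA] <-].
rewrite fsbig_finite// sumEFin lee_fin.
set F := fset_set X; pose N := (\max_(s <- F) size s).+1.
apply: le_trans (hc N); rewrite /halt_mass.
(* [M s] finds [hp s] as one entry of a double sum over lengths and words. Once the sums are
   exchanged, each word is counted at most once. *)
pose M s := \sum_(m <= i < N) \sum_(t <- words i | halts t)
  (if t == s then hp t else 0).
have M_ge0 i s : 0 <= \sum_(t <- words i | halts t) (if t == s then hp t else 0).
  by apply: sumr_ge0 => t _; case: ifP => // _; exact: history_prob_ge0.
apply: (@le_trans _ _ (\sum_(s <- F) M s)).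
  rewrite big_seq [leRHS]big_seq; apply: ler_sum => s sF.
  have [hs ms] : halts s /\ (m <= size s)%N.
    by apply: hA; apply: XA; move: sF; rewrite in_fset_set// => /set_mem.
  have [->|/mem_words sw] := eqVneq (hp s) 0; first exact: sumr_ge0.
  have sN : (size s < N)%N by rewrite ltnS; apply: leq_bigmax_seq.
  rewrite /M (bigD1_seq (size s)) ?iota_uniq ?mem_index_iota ?ms//=.
  rewrite -[leLHS]addr0 lerD ?sumr_ge0// big_mkcond.
  rewrite (bigD1_seq s) ?words_uniq//= eqxx hs.
  rewrite lerDl sumr_ge0// => t _; case: ifP => // _; case: ifP => // _.
  exact: history_prob_ge0.
rewrite /M exchange_big; apply: ler_sum => i _ /=.
rewrite exchange_big; apply: ler_sum => t _ /=.
rewrite -big_mkcond /=; under eq_bigl do rewrite eq_sym.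
have [tF|tF] := boolP (t \in F); first by rewrite -big_filter filter_pred1_uniq
  ?fset_uniq// big_seq1.
rewrite big_seq_cond big1 ?history_prob_ge0// => s /andP[sF /eqP st].
by rewrite -st sF in tF.
Qed.

Lemma esum_halts_le1 (A : set (seq R)) :
  (forall s, A s -> halts s) -> (\esum_(s in A) (hp s)%:E <= 1)%E.
Proof.
move=> hA; apply: (@esum_halts_le _ 0) => [s /hA//|N].
by rewrite big_mkord sum_halt_mass_le1.
Qed.

Lemma esum_halts_fin (A : set (seq R)) : (forall s, A s -> halts s) ->
  exists2 p : R, (\esum_(s in A) (hp s)%:E)%E = p%:E & 0 <= p <= 1.
Proof.
move=> /esum_halts_le1 p1.
have p0 : (0 <= \esum_(s in A) (hp s)%:E)%E.
  by apply: esum_ge0 => s _; rewrite lee_fin history_prob_ge0.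
have pfin : (\esum_(s in A) (hp s)%:E)%E \is a fin_num.
  by rewrite ge0_fin_numE// (le_lt_trans p1)// ltry.
by exists (fine (\esum_(s in A) (hp s)%:E)%E); rewrite -?lee_fin fineK// p0.
Qed.

(** The expected number of calls is the sum over [k] of the probability of making more than [k]
    calls; truncating at [m] leaves a sum over a finite set of querying histories. *)
Lemma sum_query_mass_le m :
  ((\sum_(k < m) query_mass k)%:E <=
   \esum_(s in [set s | exists b, f s = inl b]) (hp s)%:E)%E.
Proof.
pose W := [seq s | k <- iota 0 m, s <- words k].
have WE (F : seq R -> R) : \sum_(k < m) \sum_(s <- words k | ~~ halts s) F s =
    \sum_(s <- [seq s <- W | ~~ halts s]) F s.
  rewrite big_filter [RHS]big_mkcond /W (big_allpairs_dep (h := fun _ s => s)).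
  under [RHS]eq_bigr do rewrite -big_mkcond.
  rewrite -(big_mkord xpredT (fun k => \sum_(s <- words k | ~~ halts s) F s)).
  by rewrite /index_iota subn0.
have Wu : uniq W.
  apply: allpairs_uniq_dep => /= [|k _|]; first exact: iota_uniq.
    exact: words_uniq.
  move=> [k s] [l t] /allpairsPdep[k' [s' [_ hs]]] [-> ->].
  move=> /allpairsPdep[l' [t' [_ ht]]] [-> ->] /= st.
  by rewrite -(size_words hs) -(size_words ht) st.
rewrite /query_mass WE -sumEFin fsbig_seq ?filter_uniq//.
apply: ereal_sup_ubound; exists [set` [seq s <- W | ~~ halts s]] => //.
split; first exact: finite_seq.
move=> s /=; rewrite mem_filter /halts => /andP[+ _].
by case: (f s) => // b _; exists b.
Qed.

(** Markov's inequality: the probability of halting after at least [N] answers is at most each of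
    [query_mass 0], ..., [query_mass (N - 1)], whose sum is at most the expected number of calls. *)
Lemma late_halts_le (A : set (seq R)) N :
  (forall s, A s -> halts s /\ (N <= size s)%N) ->
  (N%:R%:E * (\esum_(s in A) (hp s)%:E) <=
   \esum_(s in [set s | exists b, f s = inl b]) (hp s)%:E)%E.
Proof.
move=> hA; apply: le_trans (sum_query_mass_le N).
have [e eE _] := esum_halts_fin (fun s As => (hA s As).1).
rewrite eE -EFinM lee_fin mulr_natl -[in leLHS](card_ord N) -sumr_const.
apply: ler_sum => k _; rewrite -lee_fin -eE; apply: esum_halts_le hA _ => M.
exact: late_halt_mass.
Qed.

End Histories.

(** * Lower integrals *)

Section LowerIntegral.
Context d (T : measurableType d) (R : realType).
Local Open Scope ereal_scope.
Import HBNNSimple.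

(** The integral of a nonnegative function is a supremum over its simple minorants, so monotonicity
    needs no measurability. *)
Lemma le_integralT (mu : {measure set T -> \bar R}) (f g : T -> \bar R) :
  (forall x, 0 <= f x) -> (forall x, f x <= g x) ->
  \int[mu]_x f x <= \int[mu]_x g x.
Proof.
move=> f0 fg; rewrite !ge0_integralTE//; last by move=> x; exact: le_trans (fg x).
by apply: le_ereal_sup => _ [h hf <-]; exists h => // x; exact: le_trans (fg x).
Qed.

Lemma lt_integral_nnsfun (mu : {measure set T -> \bar R}) (f : T -> \bar R) c :
  (forall x, 0 <= f x) -> c < \int[mu]_x f x ->
  exists h : {nnsfun T >-> R},
    (forall x, (h x)%:E <= f x) /\ c < \int[mu]_x (h x)%:E.
Proof.
move=> f0; rewrite ge0_integralTE// => /ereal_sup_gt[_ [h hf <-] ch].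
by exists h; rewrite integralT_nnsfun.
Qed.

(* [F0], [F] and [cost] need not be measurable: the comparison is made between
   simple minorants of [F0] and [F], whose combination minorizes [cost]. *)
Lemma integral_comparison (P : probability T R) (J : finType)
    (F0 : T -> \bar R) (F : J -> T -> \bar R) (cost : T -> \bar R)
    (a b k r : R) :
  (0 <= a)%R -> (0 <= b)%R -> (0 <= k)%R ->
  (forall w, 0 <= F0 w) -> (forall j w, 0 <= F j w) -> (forall w, 0 <= cost w) ->
  (forall w (x0 : R) (x : J -> R), x0%:E <= F0 w -> (forall j, (x j)%:E <= F j w) ->
     (a * x0 + b * \sum_j x j - k)%:E <= cost w) ->
  r%:E < \int[P]_w F0 w -> (forall j, r%:E < \int[P]_w F j w) ->
  (a * r + b * (r *+ #|J|) - k)%:E <= \int[P]_w cost w.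
Proof.
move=> a0 b0 k0 F00 Fj0 c0 H rF0 rF.
have [h0 [h0F rh0]] := lt_integral_nnsfun F00 rF0.
have [h hP] := choice (fun j => lt_integral_nnsfun (Fj0 j) (rF j)).
(* Because of [- k] the combination may be negative. Truncation at 0 gives a nonnegative minorant of
   [cost], and [k] is carried to the other side as the integral of a constant. *)
pose g w := Num.max (a * h0 w + b * \sum_j h j w - k)%R 0%R.
have mh0 : measurable_fun setT h0 by [].
have mh j : measurable_fun setT (h j) by [].
have mg0 : measurable_fun setT (fun w => a * h0 w + b * \sum_j h j w)%R.
  apply: measurable_funD; apply: measurable_funM => //.
  exact: measurable_sum.
have mg : measurable_fun setT g.
  apply: measurable_maxr => //.
  by apply: measurable_funB.
have le1 : \int[P]_w (g w)%:E <= \int[P]_w cost w.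
  apply: le_integralT => w; first by rewrite lee_fin /g le_max lexx orbT.
  rewrite /g; case: (leP _ 0%R) => _; first exact: c0.
  by apply: H => [|j]; [exact: h0F|exact: (hP j).1].
apply: le_trans le1; rewrite EFinB leeBlDr//.
have -> : \int[P]_w (g w)%:E + k%:E = \int[P]_w ((g w)%:E + k%:E).
  rewrite ge0_integralD//.
  - by rewrite integral_cst// -[X in _ + _ * X]/(P setT) probability_setT mule1.
  - by move=> w _; rewrite lee_fin /g le_max lexx orbT.
  - exact/measurable_EFinP.
apply: (@le_trans _ _ (\int[P]_w (a * h0 w + b * \sum_j h j w)%:E)); last first.
  apply: le_integralT => w.
    rewrite lee_fin addr_ge0// mulr_ge0// ?sumr_ge0// => *; exact: fun_ge0.
  by rewrite -EFinD lee_fin /g -lerBlDr le_max lexx.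
have h0_ge0 w : 0 <= (h0 w)%:E by rewrite lee_fin; exact: fun_ge0.
have h_ge0 j w : 0 <= (h j w)%:E by rewrite lee_fin; exact: fun_ge0.
under eq_integral do rewrite EFinD !EFinM.
rewrite ge0_integralD//; first last.
- apply/measurable_EFinP; apply: measurable_funM => //; exact: measurable_sum.
- move=> w _; rewrite mule_ge0// ?lee_fin// sumr_ge0// => *; exact: fun_ge0.
- by apply/measurable_EFinP; apply: measurable_funM.
- by move=> w _; rewrite mule_ge0.
rewrite !ge0_integralZl_EFin//; first last.
- exact/measurable_EFinP.
- by apply/measurable_EFinP; exact: measurable_sum.
- by move=> w _; rewrite lee_fin sumr_ge0// => *; exact: fun_ge0.
under [X in _ <= _ + _ * X]eq_integral do rewrite -sumEFin.
rewrite ge0_integral_sum//; last by move=> j; exact/measurable_EFinP.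
rewrite EFinD !EFinM leeD// lee_wpmul2l ?lee_fin//; first exact: ltW.
rewrite -sumr_const -sumEFin; apply: lee_sum => j _; exact: ltW (hP j).2.
Qed.

End LowerIntegral.

(** * Change of measure *)

Lemma esumZ_le (R : realType) (T : choiceType) (A : set T) (h : T -> R) (c : R) :
  0 <= c -> (forall x, 0 <= h x) ->
  (\esum_(x in A) (c * h x)%:E <= c%:E * \esum_(x in A) (h x)%:E)%E.
Proof.
move=> c0 h0; apply: ge_ereal_sup => _ [X [finX XA] <-].
rewrite fsbig_finite//= sumEFin -mulr_sumr EFinM lee_wpmul2l ?lee_fin//.
by apply: esum_ge; exists X; rewrite // fsbig_finite//= sumEFin.
Qed.

Section ChangeOfMeasure.
Context {R : realType} {n : R} {Out : Type}.
Variables (I0 : instance n) (J : finType) (I : J -> instance n) (kappa : R).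
Variable G : J -> R -> R -> R.
Hypothesis J_gt0 : (0 < #|J|)%N.
Hypothesis kappa_gt0 : 0 < kappa.
Hypothesis gibbs_ge : forall j b x, bmin I0 <= b <= bmax I0 ->
  gibbs I0 b x * expR (G j b x) <= gibbs (I j) b x.
Hypothesis sum_G : forall b x, bmin I0 <= b <= bmax I0 -> Defs.count I0 x != 0 ->
  - (#|J|%:R * kappa) <= \sum_j G j b x.

(** Lower bounds on log-likelihood ratios add up along the history, giving each [j] an exponent.
    Only the mean of these exponents is controlled, and convexity of the exponential turns this into
    a bound on the mean of the probabilities. *)
Lemma sum_history_prob (f : seq R -> R + Out) s :
  (forall s b, f s = inl b -> bmin I0 <= b <= bmax I0) ->
  #|J|%:R * history_prob I0 f s * expR (- (kappa * (size s)%:R)) <=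
  \sum_j history_prob (I j) f s.
Proof.
move=> fr.
have [h0|h0] := eqVneq (history_prob I0 f s) 0.
  by rewrite h0 mulr0 mul0r sumr_ge0// => j _; exact: history_prob_ge0.
have [g [hg sg]] : exists g : J -> R,
    (forall j, history_prob I0 f s * expR (g j) <= history_prob (I j) f s) /\
    - (#|J|%:R * (kappa * (size s)%:R)) <= \sum_j g j.
  elim/last_ind: s h0 => [|s x IH] h0.
    exists (fun=> 0); split=> [j|]; first by rewrite !history_prob_nil expR0 mulr1.
    by rewrite big1// mulr0 mulr0 oppr0.
  move: h0; rewrite history_prob_rcons mulf_eq0 negb_or => /andP[hs].
  case E : (f s) => [b|o]; last by rewrite eqxx.
  move=> gx; have [g [hg sg]] := IH hs; have br := fr _ _ E.
  have cx : Defs.count I0 x != 0.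
    by apply: contra gx => /eqP cx; rewrite /gibbs cx !mul0r.
  exists (fun j => g j + G j b x); split=> [j|].
    rewrite history_prob_rcons E expRD mulrACA.
    apply: ler_pM; [| |exact: hg|exact: gibbs_ge].
      by rewrite mulr_ge0 ?expR_ge0 ?history_prob_ge0.
    by rewrite mulr_ge0 ?expR_ge0 ?gibbs_ge0.
  rewrite big_split size_rcons /= -natr1 !mulrDr mulr1 opprD.
  by rewrite lerD// sum_G.
set h := history_prob I0 f s in h0 hg *; set k := kappa * _ in sg *.
have h_ge0 : 0 <= h by exact: history_prob_ge0.
apply: le_trans (ler_sum _ (fun j _ => hg j)).
rewrite -mulr_sumr [_ * h]mulrC -mulrA ler_wpM2l//.
(* Jensen: [expR] lies above its tangent at the mean [- k] of the exponents. *)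
apply: (@le_trans _ _ (\sum_j expR (- k) * (1 + (g j + k)))).
  rewrite -mulr_sumr mulrC ler_wpM2l ?expR_ge0//.
  rewrite !big_split /= !sumr_const -[X in _ <= _ + (_ + X)]mulr_natl.
  by rewrite lerDl -lerBlDr sub0r.
apply: ler_sum => j _.
by rewrite -{2}(addrK k (g j)) expRD mulrC ler_wpM2r ?expR_ge0// expR_ge1Dx.
Qed.

Variables (P : instance n -> set Out) (g : R).
Hypothesis same_bmin : forall j, bmin (I j) = bmin I0.
Hypothesis same_bmax : forall j, bmax (I j) = bmax I0.
Hypothesis disjoint_outputs : forall j o, P I0 o -> ~ P (I j) o.

Let halt_prob (K : instance n) f (E : set Out) : \bar R :=
  (\esum_(s in [set s | exists2 o, E o & f s = inr o]) (history_prob K f s)%:E)%E.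

Let halt_probE K f E : exists2 p : R, halt_prob K f E = p%:E & 0 <= p <= 1.
Proof.
by apply: esum_halts_fin => s [ o _]; rewrite /halts => ->.
Qed.

(** No history halts in both sets, so the two sums, extended by 0 to [D], add up to at most the mass
    of the halting histories in [D]. *)
Let disjoint_halt_prob K f E F : (forall o, E o -> ~ F o) ->
  (halt_prob K f E + halt_prob K f F <= 1)%E.
Proof.
move=> EF; pose D := [set s | exists2 o, (E `|` F) o & f s = inr o].
have -> : halt_prob K f E = (\esum_(s in D)
    if s \in [set s | exists2 o, E o & f s = inr o] then (history_prob K f s)%:E
      else 0)%E.
  rewrite -esum_mkcondr; congr esum; apply/seteqP; split=> [s [ o Eo fo]|s []//].
  by split; exists o => //; left.
have -> : halt_prob K f F = (\esum_(s in D)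
    if s \in [set s | exists2 o, F o & f s = inr o] then (history_prob K f s)%:E
      else 0)%E.
  rewrite -esum_mkcondr; congr esum; apply/seteqP; split=> [s [ o Eo fo]|s []//].
  by split; exists o => //; right.
rewrite -esumD; last 2 first.
- by move=> s _; case: ifP => // _; rewrite lee_fin history_prob_ge0.
- by move=> s _; case: ifP => // _; rewrite lee_fin history_prob_ge0.
apply: (@le_trans _ _ (\esum_(s in D) (history_prob K f s)%:E)%E); last first.
  by apply: esum_halts_le1 => s [ o _]; rewrite /halts => ->.
apply: le_esum => s _; case: ifP => [/set_mem[ o Eo fo]|_].
  rewrite ifF ?adde0//; apply/negP => /set_mem[ o' Fo' fo'].
  by move: fo'; rewrite fo => -[oo']; apply: (EF o Eo); rewrite oo'.
by rewrite add0e; case: ifP => // _; rewrite lee_fin history_prob_ge0.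
Qed.

(** For a fixed seed, success on [I0] splits into early halts, of mass [e], and halts after at least
    [N] answers, of mass [y]. The early ones are failures on every [I j], whence the bound on [e]
    after the change of measure; the late ones cost [N * y] calls. The bound is affine in [x0] and
    [x], so it can be integrated over the seed. *)
Lemma pointwise_change_of_measure (f : seq R -> R + Out) (N : nat) (L : R)
    (x0 : R) (x : J -> R) :
  (forall s b, f s = inl b -> bmin I0 <= b <= bmax I0) ->
  (forall k, (k < N)%N -> expR (kappa * k%:R) <= L) -> 0 <= L ->
  (x0%:E <= halt_prob I0 f (P I0))%E ->
  (forall j, (x j)%:E <= halt_prob (I j) f (P (I j)))%E ->
  ((N%:R * x0 + N%:R * L / #|J|%:R * \sum_j x j - N%:R * L)%:E <=
   \esum_(s in [set s | exists b, f s = inl b]) (history_prob I0 f s)%:E)%E.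
Proof.
move=> fr hL L0 hx0 hx.
pose D := [set s | exists2 o, P I0 o & f s = inr o].
pose B := [set s : seq R | (size s < N)%N].
have jpos : 0 < #|J|%:R :> R by rewrite ltr0n.
have [|e eE /andP[e0 _]] := @esum_halts_fin _ _ _ I0 f (D `&` B).
  by move=> s [[ o _]]; rewrite /halts => ->.
have [|y yE /andP[y0 _]] := @esum_halts_fin _ _ _ I0 f (D `&` ~` B).
  by move=> s [[ o _]]; rewrite /halts => ->.
have hey : x0 <= e + y.
  move: hx0; rewrite /halt_prob -/D (esumID B); last first.
    by move=> s _; rewrite lee_fin history_prob_ge0.
  by rewrite eE yE -EFinD lee_fin.
have late : ((N%:R * y)%:E <=
    \esum_(s in [set s | exists b, f s = inl b]) (history_prob I0 f s)%:E)%E.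
  rewrite EFinM -yE; apply: late_halts_le => s [[ o _ fo] sB].
  by split; [rewrite /halts fo|rewrite leqNgt; exact/negP].
have early : e <= L / #|J|%:R * \sum_j (1 - x j).
  have c0 : 0 <= L / #|J|%:R by rewrite divr_ge0// ltW.
  rewrite -lee_fin -eE.
  apply: (@le_trans _ _ (\esum_(s in D) \sum_j ((L / #|J|%:R) * history_prob (I
    j) f s)%:E)%E).
    rewrite esum_mkcondr; apply: le_esum => s _; rewrite sumEFin -mulr_sumr.
    case: ifP => [/set_mem sN|_]; last first.
      by rewrite lee_fin mulr_ge0// sumr_ge0// => j _; exact: history_prob_ge0.
    rewrite lee_fin mulrAC ler_pdivlMr//.
    apply: le_trans (ler_wpM2l L0 (sum_history_prob s fr)).
    rewrite expRN mulrA ler_pdivlMr ?expR_gt0//.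
    rewrite [leRHS]mulrC [#|J|%:R * _]mulrC.
    by rewrite ler_wpM2l ?mulr_ge0 ?history_prob_ge0 ?hL// ltW.
  rewrite esum_sum; last first.
    by move=> s j _ _; rewrite lee_fin mulr_ge0 ?history_prob_ge0.
  rewrite mulr_sumr -sumEFin; apply: lee_sum => j _.
  have Z := esumZ_le D c0 (history_prob_ge0 (I j) f); apply: (le_trans Z).
  rewrite (EFinM (L / #|J|%:R) (1 - x j)) lee_wpmul2l ?lee_fin//.
  have := disjoint_halt_prob (I j) f (@disjoint_outputs j).
  rewrite -/(halt_prob _ _ _) EFinB leeBrDr//; apply: le_trans.
  by rewrite leeD2l.
have -> : N%:R * x0 + N%:R * L / #|J|%:R * \sum_j x j - N%:R * L =
    N%:R * (x0 - L / #|J|%:R * \sum_j (1 - x j)).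
  rewrite big_split /= sumr_const sumrN -mulr_natr mul1r.
  by field; rewrite gt_eqF.
apply: le_trans late; rewrite lee_fin ler_wpM2l//.
by rewrite lerBlDr addrC (le_trans hey)// lerD2r.
Qed.

(** With [L = 1 / (4 * g)], the failure probabilities on the [I j] allow early success on [I0] with
    probability at most about one half, so the remaining mass pays for [N] calls, where [N] is about
    [ln L / kappa]. *)
Theorem change_of_measure : 0 < g -> g <= 16^-1 ->
  requires_cost P g I0 (ln (1 / g) / (8 * kappa)).
Proof.
move=> g0 g1 A sA.
set S := A (bmin I0) (bmax I0).
have g16 : g * 16 <= 1 by rewrite -ler_pdivlMr// mul1r.
(* Since [16 * g <= 1], the square of [1 / (4 * g)] is at least [1 / g]. *)
have lng : ln (1 / g) / 2 <= ln (1 / (4 * g)).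
  have g'0 : 0 < 1 / (4 * g) by rewrite divr_gt0// mulr_gt0.
  rewrite ler_pdivrMr// mulr_natr -lnXn// ler_ln ?posrE ?exprn_gt0 ?divr_gt0
    ?mulr_gt0//.
  have -> : (1 / (4 * g)) ^+ 2 = 1 / g * (1 / (g * 16)).
    by field; rewrite gt_eqF.
  apply: ler_peMr; first by rewrite divr_ge0// ltW.
  by rewrite lter_pdivlMr ?mul1r// mulr_gt0.
have lng0 : 0 <= ln (1 / g) by rewrite ln_ge0// ler_pdivlMr//; lra.
(* At [M] the factor [expR (kappa * M)] equals [1 / (4 * g)], and every [k < N] satisfies
   [k <= M]. *)
pose M := ln (1 / (4 * g)) / kappa.
have M0 : 0 <= M.
  apply: divr_ge0; last exact: ltW.
  by apply: le_trans lng; apply: divr_ge0.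
pose N := (Num.truncn M).+1.
have NM : M <= N%:R by rewrite ltW// truncnS_gt.
pose L := 1 / (4 * g).
have L0 : 0 <= L by rewrite /L divr_ge0// mulr_ge0// ltW.
have hL k : (k < N)%N -> expR (kappa * k%:R) <= L.
  rewrite ltnS truncn_ge_nat// => kM.
  rewrite -[L]lnK ?posrE ?divr_gt0 ?mulr_gt0// ler_expR mulrC.
  by rewrite -ler_pdivlMr.
have jpos : 0 < #|J|%:R :> R by rewrite ltr0n.
(* The level [1 - 2 * g] replaces [1 - g] because simple minorants reach only levels strictly below
   the integral. *)
have := @integral_comparison _ (seed S) R (seed_law S) J
  (fun w => halt_prob I0 (Defs.next S w) (P I0))
  (fun j w => halt_prob (I j) (Defs.next S w) (P (I j)))
  (fun w => \esum_(s in [set s | exists b, Defs.next S w s = inl b])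
        (history_prob I0 (Defs.next S w) s)%:E)%E
  N%:R (N%:R * L / #|J|%:R) (N%:R * L) (1 - 2 * g).
move=> /(_ (ler0n _ _) _ (mulr_ge0 (ler0n _ _) L0)) H.
apply: le_trans (H _ _ _ _ _ _ _) => {H}.
- rewrite lee_fin.
  have -> : N%:R * (1 - 2 * g) + N%:R * L / #|J|%:R * ((1 - 2 * g) *+ #|J|) -
    N%:R * L
     = N%:R * (2^-1 - 2 * g).
    by rewrite -mulr_natr /L; field; rewrite !gt_eqF.
  apply: (@le_trans _ _ (M * (2^-1 - 2 * g))); last by rewrite ler_wpM2r//; lra.
  apply: (@le_trans _ _ (M * (3/8))); last by rewrite ler_wpM2l//; lra.
  have -> : M * (3/8) = (ln (1 / (4 * g)) * (3 / 8)) / kappa by rewrite /M mulrAC.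
  have -> : ln (1 / g) / (8 * kappa) = (ln (1 / g) / 8) / kappa by field;
    rewrite gt_eqF.
  by rewrite ler_pM2r ?invr_gt0//; lra.
- by rewrite divr_ge0// mulr_ge0.
- by move=> w; have [p -> /andP[]] := halt_probE I0 (Defs.next S w) (P I0).
- by move=> j w; have [p -> /andP[]] := halt_probE (I j) (Defs.next S w) (P (I j)).
- by move=> w; apply: esum_ge0 => s _; rewrite lee_fin history_prob_ge0.
- move=> w x0 x; apply: pointwise_change_of_measure => //.
  by move=> s b; exact: next_range.
- have := sA I0; rewrite /output_prob -/S; apply: lt_le_trans.
  by rewrite lte_fin; lra.
- move=> j; have := sA (I j); rewrite /output_prob same_bmin same_bmax -/S.
  by apply: lt_le_trans; rewrite lte_fin; lra.
Qed.

End ChangeOfMeasure.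

(** * Instances with finitely many atoms *)

Section FiniteInstances.
Context {R : realType} {n : R} {T : finType}.
Variable pt : T -> R.
Hypothesis pt_inj : injective pt.
Hypothesis pt_ground : forall t, ground n (pt t).
Implicit Types (wt h : T -> R) (b B : R) (I : instance n).

(** Summing over the fibre of [pt] gives a function on all reals without an inverse of [pt]; by
    injectivity the fibre has at most one element. *)
Definition atoms wt (x : R) : R := \sum_(t | pt t == x) wt t.

Definition partsum wt b : R := \sum_t wt t * expR (b * pt t).

Definition mu wt b t : R := wt t * expR (b * pt t) / partsum wt b.

Definition expect wt b h : R := \sum_t mu wt b t * h t.

Definition presents I wt B : Prop :=
  [/\ Defs.count I = atoms wt, bmin I = 0 & bmax I = B].

Definition tilt wt h : T -> R := fun t => wt t * expR (h t).

Lemma atoms_pt wt t : atoms wt (pt t) = wt t.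
Proof.
by rewrite /atoms (eq_bigl (pred1 t)) ?big_pred1_eq// => s /=; rewrite (inj_eq
  pt_inj).
Qed.

Lemma atoms_eq0 wt x : (forall t, pt t <> x) -> atoms wt x = 0.
Proof. by move=> ptx; rewrite /atoms big_pred0// => t; apply/eqP. Qed.

Lemma atoms_neq0 wt x : atoms wt x != 0 -> exists t, x = pt t.
Proof.
move=> h; apply: contrapT => /forallNP hx; move: h; rewrite atoms_eq0 ?eqxx//.
by move=> t /esym; exact: hx.
Qed.

Section Weights.
Variables (wt : T -> R) (t0 : T).
Hypothesis wt_gt0 : forall t, 0 < wt t.

Lemma exists_instance B : 0 < B -> exists I, presents I wt B.
Proof.
move=> B0.
have ge0 x : 0 <= atoms wt x by apply: sumr_ge0 => t _; exact: ltW.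
have gr x : atoms wt x != 0 -> ground n x by move=> /atoms_neq0[t ->].
have fin : finite_set [set x | atoms wt x != 0].
  apply: (@sub_finite_set _ _ (range pt)); last exact: finite_image.
  by move=> x /= /atoms_neq0[t ->]; exists t.
have neq0 : exists x, atoms wt x != 0.
  by exists (pt t0); rewrite atoms_pt gt_eqF.
by exists (Instance ge0 gr fin neq0 B0).
Qed.

Lemma partsum_gt0 b : 0 < partsum wt b.
Proof.
rewrite /partsum (bigD1 t0)//= ltr_pwDl ?mulr_gt0 ?expR_gt0//.
by apply: sumr_ge0 => t _; rewrite mulr_ge0 ?expR_ge0// ltW.
Qed.

Lemma mu_gt0 b t : 0 < mu wt b t.
Proof. by rewrite divr_gt0 ?partsum_gt0// mulr_gt0 ?expR_gt0. Qed.

Lemma sum_mu b : \sum_t mu wt b t = 1.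
Proof. by rewrite -mulr_suml divff// gt_eqF// partsum_gt0. Qed.

Lemma mu_le1 b t : mu wt b t <= 1.
Proof.
by rewrite -(sum_mu b) (bigD1 t)//= lerDl sumr_ge0// => s _; rewrite ltW ?mu_gt0.
Qed.

Lemma expect_gt0 b h : (forall t, 0 < h t) -> 0 < expect wt b h.
Proof.
move=> h0; rewrite /expect (bigD1 t0)//=; apply: ltr_pwDl.
  by rewrite mulr_gt0 ?mu_gt0.
by apply: sumr_ge0 => t _; rewrite ltW// mulr_gt0 ?mu_gt0.
Qed.

Lemma tilt_gt0 h t : 0 < tilt wt h t.
Proof. by rewrite mulr_gt0 ?expR_gt0. Qed.

Lemma partsum_tilt b h :
  partsum (tilt wt h) b = partsum wt b * expect wt b (expR \o h).
Proof.
rewrite /expect mulr_sumr; apply: eq_bigr => t _.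
by rewrite /tilt /mu /=; field; rewrite gt_eqF// partsum_gt0.
Qed.

Lemma mu_tilt b h t :
  mu (tilt wt h) b t = mu wt b t * expR (h t) / expect wt b (expR \o h).
Proof.
have Z0 : partsum wt b != 0 by rewrite gt_eqF// partsum_gt0.
have E0 : expect wt b (expR \o h) != 0.
  by rewrite gt_eqF// expect_gt0// => s; exact: expR_gt0.
by rewrite /mu partsum_tilt /tilt; field; rewrite Z0 E0.
Qed.

Section Presented.
Variables (I : instance n) (B : R).
Hypothesis IP : presents I wt B.

Lemma partition_fun_presents b : partition_fun I b = partsum wt b.
Proof.
have [cI _ _] := IP.
rewrite partition_funE /partsum.
have -> : \sum_t wt t * expR (b * pt t) =
    \sum_(x <- map pt (enum T)) Defs.count I x * expR (b * x).
  by rewrite big_map big_enum /=; apply: eq_bigr => t _; rewrite cI atoms_pt.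
apply: perm_big; apply: uniq_perm; first exact: fset_uniq.
  by rewrite map_inj_uniq ?enum_uniq.
move=> x; rewrite in_supp cI; apply/idP/mapP => [/atoms_neq0[t ->]|[t _ ->]].
  by exists t; rewrite ?mem_enum.
by rewrite atoms_pt gt_eqF.
Qed.

Lemma gibbs_presents b t : gibbs I b (pt t) = mu wt b t.
Proof.
by have [cI _ _] := IP; rewrite /gibbs partition_fun_presents cI atoms_pt.
Qed.

Lemma gibbs_presents0 b x : (forall t, pt t <> x) -> gibbs I b x = 0.
Proof. by have [cI _ _] := IP; move=> h; rewrite /gibbs cI atoms_eq0// !mul0r. Qed.

Lemma Delta_ge b t : 0 <= b <= B -> mu wt b t <= Delta I (pt t).
Proof.
have [_ I0 IB] := IP; move=> bB; rewrite -gibbs_presents.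
apply: ub_le_sup; last by exists b => //=; rewrite in_itv /= I0 IB.
by exists 1 => _ [c _ <-]; rewrite gibbs_presents mu_le1.
Qed.

Lemma log_ratio_presents : log_ratio I = ln (partsum wt B / partsum wt 0).
Proof.
by have [_ I0 IB] := IP; rewrite /log_ratio /part_ratio !partition_fun_presents
  I0 IB.
Qed.

End Presented.
End Weights.

(** Each [h j] yields two instances, tilted by [h j] and by its opposite. In the sum of their two
    log-likelihood ratios the values of [h j] cancel, and only the logarithm of the product of the
    two normalizations remains. There are [2 * #|J|] instances, hence the factor 2 in the
    hypothesis. *)
Lemma paired_lower_bound (Out : Type) (P : instance n -> set Out) wt (t0 : T)
    I0 B (J : finType) (h : J -> T -> R) kappa g :
  (forall t, 0 < wt t) -> presents I0 wt B -> (0 < #|J|)%N -> 0 < kappa ->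
  (forall b, 0 <= b <= B ->
     \sum_j ln (expect wt b (expR \o h j) * expect wt b (expR \o (\- h j))) <=
     2 * #|J|%:R * kappa) ->
  (forall (s : bool) j I, presents I (tilt wt (fun t => (-1) ^+ s * h j t)) B ->
     forall o, P I0 o -> ~ P I o) ->
  0 < g -> g <= 16^-1 ->
  requires_cost P g I0 (ln (1 / g) / (8 * kappa)).
Proof.
move=> wt0 I0P J0 k0 hk hP g0 g1.
have [cI0 I0min I0max] := I0P.
have B0 : 0 < B by rewrite -I0max -I0min bmin_lt_bmax.
pose H (sj : bool * J) t := (-1) ^+ sj.1 * h sj.2 t.
have [I IP] := choice (fun sj => exists_instance t0 (tilt_gt0 wt0 (H sj)) B0).
pose E b sj := expect wt b (expR \o H sj).
have E0 b sj : 0 < E b sj by apply: expect_gt0 => // t; exact: expR_gt0.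
(* At an atom this is the exact log-likelihood ratio. Elsewhere its value is immaterial, as both
   Gibbs probabilities vanish. *)
pose G sj b x := \sum_(t | pt t == x) H sj t - ln (E b sj).
have Gpt sj b t : G sj b (pt t) = H sj t - ln (E b sj).
  by rewrite /G -[\sum_(_ | _) _]/(atoms (H sj) (pt t)) atoms_pt.
apply: (@change_of_measure R n Out I0 (bool * J)%type I kappa G).
- by rewrite card_prod card_bool muln_gt0.
- by [].
- move=> sj b x _; have [[t ->]|nx] := pselect (exists t, x = pt t).
    rewrite (gibbs_presents wt0 I0P) (gibbs_presents (tilt_gt0 wt0 (H sj)) (IP sj)).
    by rewrite Gpt mu_tilt// expRB lnK ?posrE ?E0// mulrA.
  have nx' t : pt t <> x by move=> e; apply: nx; exists t.
  by rewrite (gibbs_presents0 I0P)// mul0r (gibbs_presents0 (IP sj)).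
- move=> b x; rewrite I0min I0max => bB; rewrite cI0 => /atoms_neq0[t ->].
  under eq_bigr do rewrite Gpt.
  rewrite -(pair_bigA _ (fun s j => H (s, j) t - ln (E b (s, j)))) big_bool /=.
  rewrite -big_split /= card_prod card_bool natrM lerNl -sumrN.
  apply: le_trans (hk b bB); apply: ler_sum => j _.
  have En (s : bool) : E b (s, j) = expect wt b (if s then expR \o (\- h j) else
    expR \o h j).
    by apply: eq_bigr => u _; congr (_ * _); case: s => /=; rewrite /H /= ?expr1
      ?mulN1r ?expr0 ?mul1r.
  rewrite !En lnM; last 2 first.
  - by rewrite posrE expect_gt0// => u; rewrite expR_gt0.
  - by rewrite posrE expect_gt0// => u; rewrite expR_gt0.
  by rewrite /H /= expr1 expr0 mulN1r mul1r; lra.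
- by move=> sj; have [_ -> _] := IP sj.
- by move=> sj; have [_ _ ->] := IP sj.
- by move=> [s j] o; apply: hP; exact: (IP (s, j)).
- by [].
- by [].
Qed.

End FiniteInstances.

(** * Incompatible outputs *)

Lemma expR_le_1D2x (R : realType) (x : R) : `|x| <= 2^-1 -> expR x <= 1 + 2 * `|x|.
Proof.
move=> x2; have [x0|x0] := leP 0 x.
  rewrite ger0_norm// in x2 *.
  have : 1 - x <= expR (- x) by rewrite -[- x in leLHS]mulN1r mulN1r expR_ge1Dx.
  rewrite expRN => h.
  have e0 := expR_gt0 x.
  have h' : (1 - x) * expR x <= 1 by rewrite -ler_pdivlMr// div1r.
  have : expR x <= 2 by nra.
  nra.
apply: (@le_trans _ _ 1); first by rewrite expR_le1 ltW.
by rewrite lerDl mulr_ge0.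
Qed.

Section Disjointness.
Context {R : realType} {n : R} {T : finType}.
Variable pt : T -> R.
Hypothesis pt_inj : injective pt.
Hypothesis pt_ground : forall t, ground n (pt t).
Variables (wt g : T -> R) (t0 : T) (B : R) (I0 I1 : instance n).
Hypothesis wt_gt0 : forall t, 0 < wt t.
Hypothesis I0P : presents pt I0 wt B.
Hypothesis I1P : presents pt I1 (tilt wt g) B.

Local Notation mu := (mu pt wt).
Local Notation expect b h := (expect pt wt b h).

Let B_gt0 : 0 < B.
Proof. by have [_ <- <-] := I0P; exact: bmin_lt_bmax. Qed.

Let expect_exp_gt0 b : 0 < expect b (expR \o g).
Proof. by apply: expect_gt0 => // t; exact: expR_gt0. Qed.

(** The tilt multiplies the partition function at each [b] by the mean of [expR \o g], so the log
    partition ratio moves by the difference of the two logarithms. One estimate cannot be within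
    [eps] of two values more than [2 * eps] apart. *)
Lemma P_ratio_disjoint (eps : R) :
  2 * eps < `|ln (expect B (expR \o g)) - ln (expect 0 (expR \o g))| ->
  forall o, P_ratio eps I0 o -> ~ P_ratio eps I1 o.
Proof.
move=> hg o [_ h0] [_ h1].
have Z0 b := partsum_gt0 pt t0 wt_gt0 b.
have [_ _ I1max] := I1P; have [_ _ I0max] := I0P.
have e0 : ln (part_ratio I0 (bmax I0)) = ln (partsum pt wt B / partsum pt wt 0).
  exact: (log_ratio_presents pt_inj wt_gt0 I0P).
have e1 : ln (part_ratio I1 (bmax I1)) =
    ln (partsum pt (tilt wt g) B / partsum pt (tilt wt g) 0).
  exact: (log_ratio_presents pt_inj (tilt_gt0 wt_gt0 g) I1P).
rewrite e0 in h0; rewrite e1 !(partsum_tilt pt t0 wt_gt0) in h1.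
have : ln (partsum pt wt B * expect B (expR \o g) /
    (partsum pt wt 0 * expect 0 (expR \o g))) =
    ln (partsum pt wt B / partsum pt wt 0) +
    (ln (expect B (expR \o g)) - ln (expect 0 (expR \o g))).
  rewrite !ln_div ?posrE ?mulr_gt0 ?Z0 ?expect_exp_gt0//.
  by rewrite !lnM ?posrE ?Z0 ?expect_exp_gt0//; lra.
move=> e; rewrite e in h1; move: hg.
set D := ln _ - ln _ in h1 *; set q := ln (_ / _) in h0 h1.
rewrite ltNge => /negP; apply.
have -> : D = (ln o - q) - (ln o - (q + D)) by lra.
by apply: le_trans (ler_normB _ _) _; rewrite mulr2n mulrDl mul1r lerD.
Qed.

(** Visibility on [I0] forbids the symbol ? at [x] and at [y]. The output then commits to a ratio of
    the two counts, whose logarithm differs by [g x - g y] between the instances. *)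
Lemma Pt_count_disjoint (eps delta : R) x y b b' :
  0 <= b <= B -> 0 <= b' <= B -> delta <= mu b x -> delta <= mu b' y ->
  2 * eps < `|g x - g y| ->
  forall o, Pt_count delta eps I0 o -> ~ Pt_count delta eps I1 o.
Proof.
move=> bB b'B dx dy hg o [h0 h0'] [h1 _].
have [[c0 _ _] [c1 _ _]] := (I0P, I1P).
have Dx : o (pt x) <> None.
  by apply: h0' => //; apply: le_trans dx _; exact: (Delta_ge pt_inj t0 wt_gt0 I0P).
have Dy : o (pt y) <> None.
  by apply: h0' => //; apply: le_trans dy _; exact: (Delta_ge pt_inj t0 wt_gt0 I0P).
case ox : (o (pt x)) Dx => [u|//] _; case oy : (o (pt y)) Dy => [v|//] _.
have [_ _ e0] := h0 _ _ _ _ (pt_ground x) (pt_ground y) ox oy.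
have [_ _ e1] := h1 _ _ _ _ (pt_ground x) (pt_ground y) ox oy.
rewrite c0 !atoms_pt// in e0; rewrite c1 !atoms_pt// /tilt in e1.
have : ln (wt x * expR (g x) / (wt y * expR (g y))) =
    ln (wt x / wt y) + (g x - g y).
  rewrite !ln_div ?posrE ?mulr_gt0 ?expR_gt0//.
  by rewrite !lnM ?posrE ?expR_gt0// !expRK; lra.
move=> e; rewrite e in e1; move: hg; rewrite ltNge => /negP; apply.
set D := g x - g y in e1 *; set q := ln (wt _ / _) in e0 e1; set w := ln _ in e0 e1.
have -> : D = (w - q) - (w - (q + D)) by lra.
by apply: le_trans (ler_normB _ _) _; rewrite mulr2n mulrDl mul1r lerD.
Qed.

(** The tilt multiplies the probability of [x] at inverse temperature 0 by a factor [r]. As [x] is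
    visible, the permitted error is at most [2 * eps] relative on [I0] and [3 * eps] on [I1]. For
    [eps] up to [25^-1] a common estimate is then impossible once the logarithm of [r] is at least
    [7 * eps] in absolute value. *)
Lemma P_count_disjoint (eps delta : R) x b :
  0 <= b <= B -> 0 < delta -> delta <= mu b x ->
  (forall t, `|g t| <= 4^-1) -> 0 < eps -> eps <= 25^-1 ->
  7 * eps <= `|g x - ln (expect 0 (expR \o g))| ->
  forall o, P_count delta eps I0 o -> ~ P_count delta eps I1 o.
Proof.
move=> bB d0 dx g4 e0 e25 hg [pih u] [h0 _] [h1 _].
have [[c0 b0 _] [c1 b1 _]] := (I0P, I1P).
have /h0[] : Defs.count I0 (pt x) != 0 by rewrite c0 atoms_pt// gt_eqF.
have /h1[] : Defs.count I1 (pt x) != 0 by rewrite c1 atoms_pt// gt_eqF// tilt_gt0.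
rewrite /gibbs_min b0 b1 (gibbs_presents pt_inj wt_gt0 I0P).
rewrite (gibbs_presents pt_inj (tilt_gt0 wt_gt0 g) I1P) mu_tilt//.
set p := pih _; set p0 := mu 0 x; set E0 := expect 0 _ in hg *.
have p00 : 0 < p0 by exact: mu_gt0.
have E00 : 0 < E0 := expect_exp_gt0 0.
have D0 : delta <= Delta I0 (pt x).
  by apply: le_trans dx _; exact: (Delta_ge pt_inj t0 wt_gt0 I0P).
(* The likelihood ratio is at least [expR (- 4^-1) / expR (4^-1)], that is [expR (- 2^-1)], which is
   at least one half. *)
have D1 : delta / 2 <= Delta I1 (pt x).
  apply: le_trans (Delta_ge pt_inj t0 (tilt_gt0 wt_gt0 g) I1P x bB).
  rewrite mu_tilt// -mulrA; apply: ler_pM => //; [exact: ltW|].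
  rewrite ler_pdivlMr ?expect_exp_gt0//.
  apply: (@le_trans _ _ (2^-1 * expR (4^-1))).
    rewrite ler_wpM2l// -[leRHS]mulr1 -[X in _ <= _ * X](sum_mu pt t0 wt_gt0 b)
      mulr_sumr.
    apply: ler_sum => t _; rewrite mulrC; apply: ler_wpM2r.
      by rewrite ltW ?mu_gt0.
    by rewrite /= ler_expR; apply: le_trans (ler_norm _) (g4 t).
  apply: (@le_trans _ _ (expR (- 4^-1))); last first.
    by rewrite ler_expR lerNl (le_trans (ler_norm _))// normrN g4.
  have -> : expR (4^-1) = expR (- 4^-1) * expR (2^-1) :> R.
    by rewrite -expRD; congr expR; lra.
  rewrite mulrCA ler_piMr ?expR_ge0//.
  have := @expR_le_1D2x R (2^-1); rewrite ger0_norm// => /(_ (lexx _)).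
  lra.
set D1' := Delta I1 _ in D1 *; set D0' := Delta I0 _ in D0 *.
have q0 : delta / D0' <= 1 by rewrite ler_pdivrMr ?mul1r// (lt_le_trans d0).
have D1'0 : 0 < D1' by apply: lt_le_trans D1; exact: divr_gt0.
have q1 : delta / D1' <= 2 by rewrite ler_pdivrMr// -ler_pdivrMl// mulrC.
set r := expR (g x) / E0.
have -> : p0 * expR (g x) / E0 = p0 * r by rewrite /r mulrA.
have r0 : 0 < r by rewrite divr_gt0 ?expR_gt0.
have lr : ln r = g x - ln E0 by rewrite ln_div ?posrE ?expR_gt0// expRK.
move=> a1 u1 a0 u0.
have {u0} u0 : `|p - p0| <= 2 * eps * p0.
  apply: le_trans a0 _; apply: le_trans u0 _.
  have : 0 <= eps * p0 by rewrite ltW// mulr_gt0.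
  nra.
have {u1} u1 : `|p - p0 * r| <= 3 * eps * (p0 * r).
  apply: le_trans a1 _; apply: le_trans u1 _.
  have : 0 <= eps * (p0 * r) by rewrite ltW// mulr_gt0// mulr_gt0.
  nra.
move: u0 u1; rewrite !ler_norml => /andP[u0 u0'] /andP[u1 u1'].
have c1' : p0 * (r * (1 - 3 * eps)) <= p0 * (1 + 2 * eps) by nra.
have c2' : p0 * (1 - 2 * eps) <= p0 * (r * (1 + 3 * eps)) by nra.
rewrite ler_pM2l// in c1'; rewrite ler_pM2l// in c2'.
rewrite -lr in hg; move: hg; rewrite ler_normr => /orP[] h.
  have : 1 + 7 * eps <= r.
    by rewrite -[r]lnK ?posrE// (le_trans _ (expR_ge1Dx _))// lerD2l.
  by nra.
have : 1 + 7 * eps <= r^-1.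
  by rewrite -[r]lnK ?posrE// -expRN (le_trans _ (expR_ge1Dx _))// lerD2l.
move=> h2; have h3 : (1 + 7 * eps) * r <= 1 by rewrite -ler_pdivlMr// div1r.
by nra.
Qed.

End Disjointness.

(** Intermediate value theorem: at [B0] the log partition ratio is at most [B0 * xmax], hence at
    most [q], and it eventually exceeds [q]. The lower bound [B0] guarantees a temperature range
    wide enough for the later constructions. *)
Lemma exists_temperature (R : realType) (T : finType) (pt wt : T -> R) (t1 : T)
    (xmax B0 q : R) :
  (forall t, 0 < wt t) -> (forall t, 0 <= pt t <= xmax) -> 0 < pt t1 ->
  0 <= B0 -> B0 * xmax <= q ->
  exists2 B, B0 <= B & ln (partsum pt wt B / partsum pt wt 0) = q.
Proof.
move=> wt0 ptx pt1 B00 Bq.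
have Z0 b := partsum_gt0 pt t1 wt0 b.
set Z := partsum pt wt 0.
have Zc : continuous (partsum pt wt).
  apply: continuous_big => [|t _ b]; first exact: add_continuous.
  apply: cvgM; first exact: cvg_cst.
  apply: (cvg_comp (fun b => b * pt t) expR); last exact: continuous_expR.
  by apply: cvgM; [exact: cvg_id|exact: cvg_cst].
(* At [B1] the atom [t1] alone contributes at least [Z * expR q]. *)
pose B1 := Num.max B0 (ln ((wt t1)^-1 * (Z * expR q)) / pt t1).
have v0 : 0 < Z * expR q by rewrite mulr_gt0 ?expR_gt0// Z0.
have hB0 : partsum pt wt B0 <= Z * expR q.
  rewrite /Z /partsum mulr_suml; apply: ler_sum => t _.
  rewrite mul0r expR0 mulr1; apply: ler_wpM2l; first exact: ltW.
  rewrite ler_expR; apply: le_trans Bq; apply: ler_wpM2l => //.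
  by have /andP[] := ptx t.
have hB1 : Z * expR q <= partsum pt wt B1.
  rewrite /partsum (bigD1 t1)//=.
  apply: (@le_trans _ _ (wt t1 * expR (B1 * pt t1))); last first.
    by rewrite lerDl sumr_ge0// => t _; rewrite ltW// mulr_gt0 ?expR_gt0.
  have w0 : 0 < (wt t1)^-1 * (Z * expR q).
    by apply: mulr_gt0; rewrite ?invr_gt0.
  rewrite -ler_pdivrMl// -[leLHS]lnK//.
  by rewrite ler_expR -ler_pdivrMr// /B1 le_max lexx orbT.
have B01 : B0 <= B1 by rewrite /B1 le_max lexx.
have [||B /[!in_itv] /= /andP[hB _] ZB] :=
  @IVT R (partsum pt wt) B0 B1 (Z * expR q) B01.
- by apply: continuous_subspaceT.
- by rewrite ge_min hB0 le_max hB1 orbT.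
by exists B => //; rewrite ZB mulrC mulKf ?gt_eqF ?Z0// expRK.
Qed.

(** * Tilted and light perturbations *)

(** From [expR y - 1 <= y * expR y] one gets that [expR y - 1 - y] is at most [y * (expR y - 1)];
    the factor [expR y - 1] is then bounded again, according to the sign of [y]. *)
Lemma expR_le_quadratic (R : realType) (y : R) :
  expR y <= 1 + y + y ^+ 2 * expR `|y|.
Proof.
have e1 : expR y - 1 <= y * expR y.
  have : 1 - y <= expR (- y) by exact: expR_ge1Dx.
  rewrite expRN => h; have e0 := expR_gt0 y.
  have : (1 - y) * expR y <= 1 by rewrite -ler_pdivlMr// div1r.
  by rewrite mulrBl mul1r => ?; lra.
have e2 := expR_ge1Dx y.
have [y0|y0] := leP 0 y.
  rewrite ger0_norm//; have : y * (expR y - 1) <= y * (y * expR y) by exact: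
    ler_wpM2l.
  by rewrite expr2 mulrA => ?; lra.
have e3 : 1 <= expR `|y| by rewrite -expR0 ler_expR.
have : y * (expR y - 1) <= y * y by rewrite ler_nM2l//; lra.
have : y ^+ 2 <= y ^+ 2 * expR `|y| by rewrite ler_peMr// sqr_ge0.
by rewrite expr2 => ? ?; lra.
Qed.

Section Perturbations.
Context {R : realType} {n : R} {T : finType}.
Variable pt : T -> R.
Hypothesis pt_inj : injective pt.
Hypothesis pt_ground : forall t, ground n (pt t).
Variables (wt : T -> R) (t0 : T).
Hypothesis wt_gt0 : forall t, 0 < wt t.

Local Notation mu := (mu pt wt).
Local Notation E_ := (expect pt wt).

Lemma expect_le b h1 h2 : (forall t, h1 t <= h2 t) -> E_ b h1 <= E_ b h2.
Proof.
move=> h; apply: ler_sum => t _; apply: ler_wpM2l => //.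
exact: ltW (mu_gt0 _ t0 _ _ _).
Qed.

(** A perturbation supported on mass at most one sixth moves the log normalization by at most a
    third of its size: the mean of [expR \o h] lies between [1 + s * (expR (- tau) - 1)] and
    [1 + s * (expR tau - 1)], and [expR tau - 1 <= 2 * tau]. *)
Lemma ln_expect_norm_le b h tau : 0 <= tau -> tau <= 2^-1 ->
  (forall t, `|h t| <= tau) -> \sum_(t | h t != 0) mu b t <= 6^-1 ->
  `|ln (E_ b (expR \o h))| <= tau / 3.
Proof.
move=> tau0 tau2 htau hmass.
set s := \sum_(t | _) _ in hmass.
have s0 : 0 <= s by apply: sumr_ge0 => t _; exact: ltW (mu_gt0 _ t0 _ _ _).
have split c : E_ b (fun t => if h t == 0 then 1 else c) = 1 + s * (c - 1).
  have := sum_mu pt t0 wt_gt0 b; rewrite (bigID (fun t => h t != 0)) /= -/s => e1.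
  rewrite /expect (bigID (fun t => h t != 0)) /=.
  have -> : \sum_(t | h t != 0) mu b t * (if h t == 0 then 1 else c) = s * c.
    by rewrite mulr_suml; apply: eq_bigr => t /negbTE ->.
  have -> : \sum_(t | ~~ (h t != 0)) mu b t * (if h t == 0 then 1 else c) =
      \sum_(t | ~~ (h t != 0)) mu b t.
    by apply: eq_bigr => t; rewrite negbK => ->; rewrite mulr1.
  by rewrite mulrBr mulr1; lra.
have E0 : 0 < E_ b (expR \o h) by apply: expect_gt0 => // t; exact: expR_gt0.
have up : E_ b (expR \o h) <= 1 + s * (expR tau - 1).
  rewrite -split; apply: expect_le => t /=; case: eqP => [->|_]; first by
    rewrite expR0.
  by rewrite ler_expR (le_trans (ler_norm _)).
have lo : 1 + s * (expR (- tau) - 1) <= E_ b (expR \o h).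
  rewrite -split; apply: expect_le => t /=; case: eqP => [->|_]; first by
    rewrite expR0.
  by rewrite ler_expR lerNl (le_trans (ler_norm _))// normrN.
rewrite ler_norml; apply/andP; split.
  have et : - tau <= expR (- tau) - 1 by have := expR_ge1Dx (- tau); lra.
  have lo' : 1 - tau / 6 <= E_ b (expR \o h).
    apply: le_trans lo; have : s * (- tau) <= s * (expR (- tau) - 1) by exact:
      ler_wpM2l.
    by nra.
  rewrite -ler_expR lnK ?posrE//; apply: le_trans lo'.
  rewrite expRN -div1r ler_pdivrMr ?expR_gt0//.
  have e3 := expR_ge1Dx (tau / 3).
  have : (1 - tau / 6) * (1 + tau / 3) <= (1 - tau / 6) * expR (tau / 3).
    by apply: ler_wpM2l => //; lra.
  by nra.
rewrite -ler_expR lnK ?posrE//; apply: le_trans up _.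
have et : expR tau <= 1 + 2 * tau.
  by have := @expR_le_1D2x R tau; rewrite ger0_norm//; exact.
apply: le_trans (expR_ge1Dx _); rewrite lerD2l.
have : s * (expR tau - 1) <= s * (2 * tau) by apply: ler_wpM2l => //; lra.
by nra.
Qed.

Variables (eps delta gamma B : R) (I0 : instance n).
Hypothesis eps_gt0 : 0 < eps.
Hypothesis eps_le : eps <= 100^-1.
Hypothesis delta_gt0 : 0 < delta.
Hypothesis gamma_gt0 : 0 < gamma.
Hypothesis gamma_le : gamma <= 16^-1.
Hypothesis I0P : presents pt I0 wt B.

Let B_gt0 : 0 < B.
Proof. by have [_ <- <-] := I0P; exact: bmin_lt_bmax. Qed.

(** * Perturbing light atoms one at a time *)

Section Light.
Variables (J : finType) (light : J -> T) (a : R) (bl : J -> R).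
Hypothesis J_gt0 : (0 < #|J|)%N.
Hypothesis a_gt0 : 0 < a.
Hypothesis a_le : a <= 6^-1.
Hypothesis sum_light : forall b, 0 <= b <= B -> \sum_j mu b (light j) <= a.
Hypothesis bl_range : forall j, 0 <= bl j <= B.
Hypothesis light_visible : forall j, delta <= mu (bl j) (light j).

(** The normalization absorbs at most a third of [nu], so the light probability still moves by
    [8 * eps] on the log scale, more than the [7 * eps] that [P_count_disjoint] requires. *)
Let nu := 12 * eps.
Let h j t : R := if t == light j then nu else 0.

Let mu_light_le b j : 0 <= b <= B -> mu b (light j) <= a.
Proof.
move=> bB; apply: le_trans (sum_light bB).
rewrite (bigD1 j)//= lerDl sumr_ge0// => i _; exact: ltW (mu_gt0 _ t0 _ _ _).
Qed.

Let expect_light b j c :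
  E_ b (expR \o (fun t => c * (t == light j)%:R)) = 1 + mu b (light j) * (expR c
    - 1).
Proof.
rewrite /expect (bigD1 (light j))//= eqxx mulr1.
under eq_bigr => t /negbTE -> do rewrite mulr0 expR0 mulr1.
have := sum_mu pt t0 wt_gt0 b; rewrite (bigD1 (light j))//= => e.
by rewrite mulrBr mulr1; lra.
Qed.

(** With [x = expR nu], [z = expR (- nu)] and [x * z = 1], the product of normalizations is
    [1 + (p - p ^+ 2) * (x + z - 2)], at most [1 + 4 * nu ^+ 2 * p]. This is linear in the light
    mass [p], and the light masses sum to at most [a]. *)
Let light_kappa b : 0 <= b <= B ->
  \sum_j ln (E_ b (expR \o h j) * E_ b (expR \o (\- h j))) <=
  2 * #|J|%:R * (2 * nu ^+ 2 * a / #|J|%:R).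
Proof.
move=> bB.
have nu0 : 0 < nu by rewrite mulr_gt0.
have nu4 : nu <= 4^-1 by have := eps_le; rewrite /nu; lra.
have Jr : 0 < #|J|%:R :> R by rewrite ltr0n.
have -> : 2 * #|J|%:R * (2 * nu ^+ 2 * a / #|J|%:R) = 4 * nu ^+ 2 * a.
  by field; rewrite gt_eqF.
apply: (@le_trans _ _ (\sum_j 4 * nu ^+ 2 * mu b (light j))); last first.
  by rewrite -mulr_sumr ler_wpM2l ?sum_light// mulr_ge0// sqr_ge0.
apply: ler_sum => j _.
have -> : E_ b (expR \o h j) = 1 + mu b (light j) * (expR nu - 1).
  rewrite -expect_light; apply: eq_bigr => t _; congr (_ * expR _).
  by rewrite /h; case: eqP; rewrite ?mulr1 ?mulr0.
have -> : E_ b (expR \o (\- h j)) = 1 + mu b (light j) * (expR (- nu) - 1).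
  rewrite -expect_light; apply: eq_bigr => t _; congr (_ * expR _).
  by rewrite /h /=; case: eqP; rewrite ?mulr1 ?mulr0 ?oppr0.
set p := mu b _.
have p0 : 0 < p by exact: mu_gt0.
have p1 : p <= 1 by exact: mu_le1.
have e1 : expR nu * expR (- nu) = 1 by rewrite expRN mulfV// gt_eqF// expR_gt0.
have x0 := expR_gt0 nu; have y0 := expR_gt0 (- nu).
have e2 : expR `|nu| <= 2.
  have := @expR_le_1D2x R nu; rewrite (ger0_norm (ltW nu0)) => h2.
  by have /h2 : nu <= 2^-1; lra.
have e3 := expR_le_quadratic nu; have e4 := expR_le_quadratic (- nu).
rewrite normrN sqrrN in e4.
have e5 : nu ^+ 2 * expR `|nu| <= nu ^+ 2 * 2 by rewrite ler_wpM2l ?sqr_ge0.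
set x := expR nu in x0 e1 e3 *; set z := expR (- nu) in y0 e1 e4 *.
have xz : x + z - 2 <= 4 * nu ^+ 2 by lra.
have xz0 : 0 <= x + z - 2 by have := sqr_ge0 (x - 1); rewrite expr2; nra.
have pxz : p * (x + z - 2) <= 4 * nu ^+ 2 * p.
  by rewrite mulrC ler_wpM2r// ltW.
have q0 : 0 < (1 + p * (x - 1)) * (1 + p * (z - 1)).
  by apply: mulr_gt0; nra.
rewrite -ler_expR lnK ?posrE//; apply: le_trans (expR_ge1Dx _).
have -> : (1 + p * (x - 1)) * (1 + p * (z - 1)) =
    1 + p * (x + z - 2) + p ^+ 2 * (x * z - (x + z) + 1) by ring.
rewrite e1.
have := sqr_ge0 p; nra.
Qed.

Let h_signed (s : bool) j :
  (fun t => (-1) ^+ s * h j t) = (fun t => ((-1) ^+ s * nu) * (t == light j)%:R).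
Proof. by apply/funext => t; rewrite /h; case: eqP; rewrite ?mulr1 ?mulr0. Qed.

Let kappa_gt0 : 0 < 2 * nu ^+ 2 * a / #|J|%:R.
Proof. by rewrite divr_gt0 ?ltr0n// mulr_gt0// mulr_gt0// exprn_gt0// mulr_gt0. Qed.

Let cost_light :
  ln (1 / gamma) / (8 * (2 * nu ^+ 2 * a / #|J|%:R)) =
  #|J|%:R * ln (1 / gamma) / (2304 * a * eps ^+ 2).
Proof.
by rewrite /nu; field; rewrite !gt_eqF ?ltr0n.
Qed.

(** At inverse temperature 0 the perturbed atom has mass at most one sixth, so its own factor
    outweighs the change of the normalization. *)
Lemma P_count_light :
  requires_cost (P_count delta eps) gamma I0
    (#|J|%:R * ln (1 / gamma) / (2304 * a * eps ^+ 2)).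
Proof.
rewrite -cost_light.
apply: (paired_lower_bound pt_inj pt_ground t0 wt_gt0 I0P J_gt0 kappa_gt0
  light_kappa) => //.
move=> s j I IP; rewrite h_signed in IP.
have nu0 : 0 < nu by rewrite mulr_gt0.
have norm_le t : `|(-1) ^+ s * nu * (t == light j)%:R| <= nu.
  rewrite normrM [X in X * _]normrM normr_sign mul1r (gtr0_norm nu0).
  by case: eqP => _; rewrite ?mulr1n ?mulr0n ?normr1 ?normr0 ?mulr1 ?mulr0 ?lexx
    ?(ltW nu0).
have nu4 : nu <= 4^-1 by have := eps_le; rewrite /nu; lra.
apply: (P_count_disjoint pt_inj t0 wt_gt0 I0P IP (bl_range j) delta_gt0
  (light_visible j)) => //.
- by move=> t; apply: le_trans (norm_le t) _.
- by have := eps_le; lra.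
have := @ln_expect_norm_le 0 _ nu (ltW nu0) _ norm_le.
set L := ln _; rewrite eqxx mulr1.
have -> : \sum_(t | (-1) ^+ s * nu * (t == light j)%:R != 0) mu 0 t = mu 0
  (light j).
  rewrite (eq_bigl (pred1 (light j))) ?big_pred1_eq// => t /=.
  by case: (t =P light j) => _; rewrite ?mulr0 ?eqxx// mulr1 mulf_eq0 negb_or
    signr_eq0 gt_eqF.
move=> /(_ _ _)-H.
have {}H : `|L| <= nu / 3.
  apply: H; first lra.
  by apply: le_trans a_le; apply: mu_light_le; rewrite lexx ltW.
have : `|(-1) ^+ s * nu| - `|L| <= `|(-1) ^+ s * nu - L| by exact: lerB_dist.
by rewrite normrM normr_sign mul1r gtr0_norm//; rewrite /nu in H *; have :=
  eps_gt0; lra.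
Qed.

Variables (y : T) (bh : R).
Hypothesis heavy_range : 0 <= bh <= B.
Hypothesis heavy_visible : delta <= mu bh y.
Hypothesis y_heavy : forall j, light j != y.

(** Only ratios of counts are estimated, so an unperturbed visible atom [y] serves as reference. *)
Lemma Pt_count_light :
  requires_cost (Pt_count delta eps) gamma I0
    (#|J|%:R * ln (1 / gamma) / (2304 * a * eps ^+ 2)).
Proof.
rewrite -cost_light.
apply: (paired_lower_bound pt_inj pt_ground t0 wt_gt0 I0P J_gt0 kappa_gt0
  light_kappa) => //.
move=> s j I IP; rewrite h_signed in IP.
apply: (Pt_count_disjoint pt_inj pt_ground t0 wt_gt0 I0P IP (bl_range j)
  heavy_range (light_visible j) heavy_visible).
rewrite eqxx mulr1 eq_sym (negbTE (y_heavy j)) mulr0 subr0 normrM normr_sign mul1r.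
by rewrite gtr0_norm /nu; have := eps_gt0; lra.
Qed.

End Light.

(** * Linear tilts of a concentrated family *)

Section Tilt.
Variables (k : T -> R) (m C0 : R) (tb tt : T).
Hypothesis m_ge1 : 1 <= m.
Hypothesis C0_gt0 : 0 < C0.
Hypothesis k_range : forall t, 0 <= k t <= m.
Hypothesis k_bot : k tb = 0.
Hypothesis k_top : k tt = m.
Hypothesis delta_le : delta <= 2^-1.
Hypothesis mass_bot : \sum_(t | k t != 0) mu 0 t <= 6^-1.
Hypothesis mass_top : \sum_(t | k t != m) mu B t <= 6^-1.
Hypothesis concentrated : forall b, exists c,
  E_ b (fun t => expR (3 * `|k t - c|)) <= C0.
Hypothesis tb_bot : forall t, k t = 0 -> t = tb.
Hypothesis tt_top : forall t, k t = m -> t = tt.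

Let tau := 12 * eps.
Let nu := tau / m.
Let g t := nu * k t.

Let m_gt0 : 0 < m. Proof. exact: lt_le_trans m_ge1. Qed.
Let tau_gt0 : 0 < tau. Proof. by rewrite mulr_gt0. Qed.
Let nu_gt0 : 0 < nu. Proof. by rewrite divr_gt0. Qed.
Let tau_le4 : tau <= 4^-1. Proof. by have := eps_le; rewrite /tau; lra. Qed.
Let nu_le1 : nu <= 1. Proof. by rewrite ler_pdivrMr// mul1r; have := m_ge1; have
  := tau_le4; lra. Qed.

(** Centring [k] at [c] leaves the product unchanged. To second order the factors are
    [1 + nu * A + D] and [1 - nu * A + D], with product at most [(1 + D) ^+ 2]: the means cancel and
    only the exponential moment around [c] matters. *)
Let tilt_kappa b : 
  ln (E_ b (expR \o g) * E_ b (expR \o (\- g))) <= 2 * (nu ^+ 2 * C0).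
Proof.
have [c hc] := concentrated b.
pose Y t := k t - c.
have bound (s : R) : `|s| = nu ->
    E_ b (fun t => expR (s * Y t)) <= 1 + s * E_ b Y + nu ^+ 2 * C0.
  move=> sn.
  apply: (@le_trans _ _ (E_ b (fun t => 1 + s * Y t + nu ^+ 2 * expR (3 * `|Y
    t|)))).
    apply: expect_le => t; apply: le_trans (expR_le_quadratic _) _.
    rewrite lerD2l exprMn -(real_normK (num_real s)) sn -mulrA ler_wpM2l ?sqr_ge0//.
    (* Two of the three copies dominate the square of [Y t], the third dominates [expR] of the
       absolute value of [s * Y t], as [nu <= 1]. *)
    have -> : 3 * `|Y t| = `|Y t| + `|Y t| + `|Y t| by lra.
    have y0 := normr_ge0 (Y t).
    have ey : `|Y t| <= expR `|Y t| by have := expR_ge1Dx `|Y t|; lra.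
    rewrite 2!expRD -(real_normK (num_real (Y t))) expr2.
    apply: ler_pM => //; rewrite ?mulr_ge0 ?expR_ge0//; first exact: ler_pM.
    by rewrite ler_expR normrM sn ler_piMl.
  have -> : E_ b (fun t => 1 + s * Y t + nu ^+ 2 * expR (3 * `|Y t|)) =
      1 + s * E_ b Y + nu ^+ 2 * E_ b (fun t => expR (3 * `|Y t|)).
    rewrite -[X in X + _ + _](sum_mu pt t0 wt_gt0 b) /expect !mulr_sumr
      -!big_split /=.
    by apply: eq_bigr => t _; ring.
  by rewrite lerD2l ler_wpM2l ?sqr_ge0.
have shift (s : R) : E_ b (fun t => expR (s * k t)) =
    expR (s * c) * E_ b (fun t => expR (s * Y t)).
  rewrite /expect mulr_sumr; apply: eq_bigr => t _.
  by rewrite mulrCA -expRD; congr (_ * expR _); rewrite /Y; ring.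
have -> : expR \o g = (fun t => expR (nu * k t)) by [].
have -> : expR \o (\- g) = (fun t => expR (- nu * k t)).
  by apply/funext => t /=; rewrite /g mulNr.
rewrite (shift nu) (shift (- nu)) mulrACA -expRD mulNr subrr expR0 mul1r.
have b1 := bound nu (gtr0_norm nu_gt0).
have b2 : E_ b (fun t => expR (- nu * Y t)) <= 1 + - nu * E_ b Y + nu ^+ 2 * C0.
  by apply: bound; rewrite normrN gtr0_norm.
have e1 : 0 < E_ b (fun t => expR (nu * Y t)).
  by apply: expect_gt0 => // t; exact: expR_gt0.
have e2 : 0 < E_ b (fun t => expR (- nu * Y t)).
  by apply: expect_gt0 => // t; exact: expR_gt0.
rewrite -ler_expR lnK ?posrE ?mulr_gt0//.
have := ler_pM (ltW e1) (ltW e2) b1 b2; move/le_trans; apply.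
set D := nu ^+ 2 * C0; set A := E_ b Y.
have -> : (1 + nu * A + D) * (1 + - nu * A + D) = (1 + D) ^+ 2 - (nu * A) ^+ 2
  by ring.
have D0 : 0 <= D by rewrite mulr_ge0 ?sqr_ge0// ltW.
apply: (@le_trans _ _ ((1 + D) ^+ 2)); first by rewrite lerBlDr lerDl sqr_ge0.
have -> : 2 * D = D + D by ring.
by rewrite expRD expr2; apply: ler_pM; rewrite ?expR_ge1Dx// addr_ge0.
Qed.

Let kappa_gt0 : 0 < nu ^+ 2 * C0.
Proof. by rewrite mulr_gt0// exprn_gt0. Qed.

Let cost_tilt :
  ln (1 / gamma) / (8 * (nu ^+ 2 * C0)) =
  m ^+ 2 * ln (1 / gamma) / (1152 * C0 * eps ^+ 2).
Proof. by rewrite /nu /tau; field; rewrite !gt_eqF. Qed.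

Let g_range t : 0 <= g t <= tau.
Proof.
have /andP[k0 km] := k_range t.
apply/andP; split; first by apply: mulr_ge0 => //; exact: ltW.
by rewrite /g /nu mulrAC ler_pdivrMr// ler_pM2l.
Qed.

Let g_norm (s : bool) t : `|(-1) ^+ s * g t| <= tau.
Proof. by rewrite normrM normr_sign mul1r; have /andP[? ?] := g_range t; rewrite
  ger0_norm. Qed.

Let g_top : g tt = tau.
Proof. by rewrite /g k_top /nu mulrVK// unitfE gt_eqF. Qed.

Let ln_bot (s : bool) :
  `|ln (E_ 0 (expR \o (fun t => (-1) ^+ s * g t)))| <= tau / 3.
Proof.
apply: ln_expect_norm_le => //; [exact: ltW|by have := tau_le4; lra|].
rewrite (eq_bigl (fun t => k t != 0)) // => t.
by rewrite mulf_eq0 signr_eq0 /= mulf_eq0 (gt_eqF nu_gt0).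
Qed.

(** At [B] most of the mass is where [g] equals [tau]. Factoring out that value leaves a
    perturbation supported on mass at most one sixth. *)
Let ln_top (s : bool) :
  `|ln (E_ B (expR \o (fun t => (-1) ^+ s * g t))) - (-1) ^+ s * tau| <= tau / 3.
Proof.
have -> : ln (E_ B (expR \o (fun t => (-1) ^+ s * g t))) =
    (-1) ^+ s * tau + ln (E_ B (expR \o (fun t => (-1) ^+ s * (g t - tau)))).
  rewrite -[X in X + _](@expRK R) -lnM ?posrE ?expR_gt0//; last first.
    by apply: expect_gt0 => // t; exact: expR_gt0.
  congr ln; rewrite /expect mulr_sumr; apply: eq_bigr => t _ /=.
  by rewrite [RHS]mulrCA -expRD; congr (_ * expR _); ring.
rewrite addrC addKr.
apply: ln_expect_norm_le => //; [exact: ltW|by have := tau_le4; lra| |].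
  move=> t; rewrite normrM normr_sign mul1r ler0_norm; have := g_range t; lra.
rewrite (eq_bigl (fun t => k t != m)) // => t.
rewrite mulf_eq0 signr_eq0 /= subr_eq0 -g_top /g (inj_eq (mulfI _)) ?k_top//.
by rewrite gt_eqF.
Qed.

Let delta_visible b t : \sum_(s | s != t) mu b s <= 6^-1 -> delta <= mu b t.
Proof. by have := sum_mu pt t0 wt_gt0 b; rewrite (bigD1 t)//= => e h; have :=
  delta_le; lra. Qed.

Let visible_bot : delta <= mu 0 tb.
Proof.
apply: delta_visible; rewrite (eq_bigl (fun t => k t != 0)) // => t.
by congr (~~ _); apply/eqP/eqP => [->|/tb_bot].
Qed.

Let visible_top : delta <= mu B tt.
Proof.
apply: delta_visible; rewrite (eq_bigl (fun t => k t != m)) // => t.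
by congr (~~ _); apply/eqP/eqP => [->|/tt_top].
Qed.

Let range0 : 0 <= (0 : R) <= B. Proof. by rewrite lexx ltW. Qed.
Let rangeB : 0 <= B <= B. Proof. by rewrite lexx ltW. Qed.

Let tilt_lower_bound (Out : Type) (P : instance n -> set Out) :
  (forall (s : bool) I, presents pt I (tilt wt (fun t => (-1) ^+ s * g t)) B ->
     forall o, P I0 o -> ~ P I o) ->
  requires_cost P gamma I0 (m ^+ 2 * ln (1 / gamma) / (1152 * C0 * eps ^+ 2)).
Proof.
move=> hP; rewrite -cost_tilt.
apply: (@paired_lower_bound _ _ _ _ pt_inj pt_ground _ P wt t0 I0 B unit (fun=>
  g)) => //.
- by rewrite card_unit.
- move=> b _; rewrite big_const card_unit /= addr0 mulr1; exact: tilt_kappa.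
- by move=> s _ I; exact: hP.
Qed.

(** The log normalization stays within [tau / 3] of 0 at inverse temperature 0 and of the signed
    [tau] at [B], so the log ratio moves by at least [tau / 3 = 4 * eps]. *)
Lemma P_ratio_tilt : requires_cost (P_ratio eps) gamma I0
  (m ^+ 2 * ln (1 / gamma) / (1152 * C0 * eps ^+ 2)).
Proof.
apply: tilt_lower_bound => s I IP.
apply: (P_ratio_disjoint pt_inj t0 wt_gt0 I0P IP).
have := ln_bot s; have := ln_top s.
set L0 := ln _; set L1 := ln _ => h1 h0.
have : `|(-1) ^+ s * tau| <= `|L0 - L1| + `|L0 - (-1) ^+ s * tau| + `|L1|.
  have {1}-> : (-1) ^+ s * tau = (L0 - L1) - (L0 - (-1) ^+ s * tau) + L1 by ring.
  by rewrite (le_trans (ler_normD _ _))// lerD2r ler_normB.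
by rewrite normrM normr_sign mul1r gtr0_norm//; rewrite /tau in h0 h1 *; have :=
  eps_gt0; lra.
Qed.

Lemma Pt_count_tilt : requires_cost (Pt_count delta eps) gamma I0
  (m ^+ 2 * ln (1 / gamma) / (1152 * C0 * eps ^+ 2)).
Proof.
apply: tilt_lower_bound => s I IP.
apply: (Pt_count_disjoint pt_inj pt_ground t0 wt_gt0 I0P IP rangeB range0
  visible_top visible_bot).
rewrite g_top /g k_bot !mulr0 subr0 normrM normr_sign mul1r gtr0_norm// /tau.
by have := eps_gt0; lra.
Qed.

(** The atom [tt] is visible because of its mass at [B], while its estimate is judged at inverse
    temperature 0, where the normalization moves by at most [tau / 3] against a factor of logarithm
    [tau]. *)
Lemma P_count_tilt : requires_cost (P_count delta eps) gamma I0
  (m ^+ 2 * ln (1 / gamma) / (1152 * C0 * eps ^+ 2)).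
Proof.
apply: tilt_lower_bound => s I IP.
apply: (P_count_disjoint pt_inj t0 wt_gt0 I0P IP rangeB delta_gt0 visible_top)
  => //.
- by move=> t; apply: le_trans (g_norm s t) _.
- by have := eps_le; lra.
rewrite g_top; have := ln_bot s; set L := ln _ => h0.
have : `|(-1) ^+ s * tau| - `|L| <= `|(-1) ^+ s * tau - L| by exact: lerB_dist.
by rewrite normrM normr_sign mul1r gtr0_norm//; rewrite /tau in h0 *; have :=
  eps_gt0; lra.
Qed.

End Tilt.
End Perturbations.

(** * Discrete Gaussian sums *)

Section Gaussian.
Context {R : realType}.
Implicit Types (th x : R) (m k c : nat).

Definition gauss th k : R := expR (th * k%:R - 3 * k%:R ^+ 2).

Definition gauss_sum m th : R := \sum_(k < m.+1) gauss th k.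

(** The 3 bounds the two-sided geometric series of [sum_half_ndist]; [expR 4] is the loss in
    [gauss_decay]. *)
Definition spread : R := 3 * expR 4.

Definition ndist k c : nat := (k - c + (c - k))%N.

Lemma gauss_gt0 th k : 0 < gauss th k. Proof. exact: expR_gt0. Qed.

Lemma gauss_sum_gt0 m th : 0 < gauss_sum m th.
Proof.
rewrite /gauss_sum big_ord_recl ltr_pwDl ?gauss_gt0//.
by apply: sumr_ge0 => k _; exact: ltW (gauss_gt0 _ _).
Qed.

Lemma le_gauss_sum m th k : (k <= m)%N -> gauss th k <= gauss_sum m th.
Proof.
move=> km; rewrite -ltnS in km; rewrite /gauss_sum (bigD1 (Ordinal km))//= lerDl.
by apply: sumr_ge0 => i _; exact: ltW (gauss_gt0 _ _).
Qed.

Lemma expR1_ge2 : 2 <= expR 1 :> R.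
Proof. by have := expR_ge1Dx (1 : R); lra. Qed.

Lemma expRN_le_half (j : nat) : expR (- j%:R) <= 2^-1 ^+ j :> R.
Proof.
have -> : - j%:R = j%:R * -1 :> R by ring.
rewrite expRM_natl lerXn2r ?nnegrE ?expR_ge0//.
by rewrite expRN lef_pV2 ?posrE ?expR_gt0 ?expR1_ge2.
Qed.

Lemma expRN3_le (j : nat) : expR (- (3 * j%:R)) <= 8^-1 ^+ j :> R.
Proof.
have -> : - (3 * j%:R) = j%:R * (3%:R * -1) :> R by ring.
rewrite 2!expRM_natl.
have -> : 8^-1 = 2^-1 ^+ 3 :> R by rewrite exprVn -natrX.
by rewrite lerXn2r ?lerXn2r ?nnegrE ?exprn_ge0 ?expR_ge0// -[-1]/(- 1%:R)
  expRN_le_half.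
Qed.

Lemma ndist_ge k c : (c <= k)%N -> ndist k c = (k - c)%N.
Proof. by move=> ck; rewrite /ndist (eqP ck) addn0. Qed.

Lemma ndist_le k c : (k <= c)%N -> ndist k c = (c - k)%N.
Proof. by move=> ck; rewrite /ndist (eqP ck) add0n. Qed.

Lemma natr_ndist k c : (ndist k c)%:R = `|k%:R - c%:R| :> R.
Proof.
have [kc|/ltnW ck] := leqP k c.
  by rewrite ndist_le// natrB// distrC ger0_norm// subr_ge0 ler_nat.
by rewrite ndist_ge// natrB// ger0_norm// subr_ge0 ler_nat.
Qed.

Lemma sum_half_ndist m c : (c <= m)%N -> \sum_(k < m.+1) 2^-1 ^+ ndist k c <= 3
  :> R.
Proof.
move=> cm; rewrite -(big_mkord xpredT (fun k => 2^-1 ^+ ndist k c)).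
rewrite (big_cat_nat (n := c))//=; last exact: leqW.
have left j : (j <= c)%N -> \sum_(0 <= k < j) 2^-1 ^+ ndist k c <= 2^-1 ^+ (c -
  j) :> R.
  elim: j => [|j IH] jc; first by rewrite big_geq// exprn_ge0.
  rewrite big_nat_recr//=; have := IH (ltnW jc).
  rewrite ndist_le ?(ltnW jc)// -(subnSK jc) exprS.
  set x := 2^-1 ^+ _; set s := \sum_(_ <= _ < _) _; lra.
have right j : \sum_(c <= k < c + j) 2^-1 ^+ ndist k c <= 2 - 2 * 2^-1 ^+ j :> R.
  elim: j => [|j IH]; first by rewrite addn0 big_geq// expr0; lra.
  rewrite addnS big_nat_recr ?leq_addr//= ndist_ge ?leq_addr// addKn exprS.
  by move: IH; set x := 2^-1 ^+ _; set s := \sum_(_ <= _ < _) _; lra.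
have := left c (leqnn c); rewrite subnn expr0.
have := right (m.+1 - c)%N; rewrite subnKC ?leqW//.
have : 0 <= 2^-1 ^+ (m.+1 - c) :> R by rewrite exprn_ge0.
lra.
Qed.

(** Comparing the peak [c] with its neighbour on the side of [k] bounds [th]. At distance [J] the
    exponent has then dropped by at least [3 * J ^+ 2 - 3 * J], which beats [4 * J - 4]. *)
Lemma gauss_decay th m c k : (c <= m)%N -> (k <= m)%N ->
  (forall l, (l <= m)%N -> gauss th l <= gauss th c) ->
  gauss th k * expR (3 * `|k%:R - c%:R|) <= gauss th c * expR 4 * 2^-1 ^+ ndist k c.
Proof.
move=> cm km peak.
apply: (@le_trans _ _ (gauss th c * expR 4 * expR (- (ndist k c)%:R))); last first.
  by rewrite ler_wpM2l ?expRN_le_half// mulr_ge0 ?expR_ge0// ltW// gauss_gt0.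
rewrite /gauss -!expRD ler_expR -natr_ndist.
have [->|nkc] := eqVneq k c; first by rewrite /ndist subnn mulr0 oppr0; lra.
have [/ltnW ck|kc] := ltnP c k.
- have [j kj] : exists j, k = (c + j.+1)%N.
    exists (k - c).-1; rewrite prednK ?subnKC// subn_gt0 ltn_neqAle eq_sym nkc
      ck //.
  have := peak c.+1; rewrite (leq_trans _ km) ?kj; last by rewrite addnS ltnS
    leq_addr.
  move=> /(_ isT); rewrite /gauss ler_expR -natr1 => h.
  rewrite ndist_ge ?leq_addr// addKn natrD.
  (* [(3 * J - 4) * (J - 1) >= 0] needs the integrality of [J]. *)
  have j1 : j.+1%:R = 1 :> R \/ 2 <= j.+1%:R :> R.
    by case: (j) => [|i]; [left|right; rewrite (ler_nat R 2)].
  have th1 : th <= 3 * (2 * c%:R + 1) by move: h; rewrite !expr2; lra.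
  have J0 : 0 <= j.+1%:R :> R by [].
  set J := j.+1%:R in j1 J0 *; set C := c%:R in th1 *.
  have : th * J <= 3 * (2 * C + 1) * J by exact: ler_wpM2r.
  by case: j1 => [->|J2]; rewrite ?expr2; nra.
- have [j cj] : exists j, c = (k + j.+1)%N.
    exists (c - k).-1; rewrite prednK ?subnKC// subn_gt0 ltn_neqAle nkc kc //.
  have cE : c%:R = k%:R + j.+1%:R :> R by rewrite cj natrD.
  have := peak c.-1; rewrite (leq_trans (leq_pred _) cm) => /(_ isT).
  have -> : c.-1 = (k + j)%N by rewrite cj addnS.
  have kjE : (k + j)%:R = c%:R - 1 :> R by rewrite cj addnS -natr1 addrK.
  rewrite /gauss ler_expR kjE => h.
  have -> : ndist k c = j.+1 by rewrite ndist_le// cj addKn.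
  have j1 : j.+1%:R = 1 :> R \/ 2 <= j.+1%:R :> R.
    by case: (j) => [|i]; [left|right; rewrite (ler_nat R 2)].
  have th1 : 3 * (2 * c%:R - 1) <= th by move: h; rewrite !expr2; lra.
  have J0 : 0 <= j.+1%:R :> R by [].
  rewrite cE in th1 *.
  set J := j.+1%:R in j1 J0 th1 *; set K := k%:R in th1 *.
  have : 3 * (2 * (K + J) - 1) * J <= th * J by exact: ler_wpM2r.
  by case: j1 => [->|J2]; rewrite ?expr2; nra.
Qed.

Lemma gauss_concentrated th m c : (c <= m)%N ->
  (forall l, (l <= m)%N -> gauss th l <= gauss th c) ->
  \sum_(k < m.+1) gauss th k * expR (3 * `|k%:R - c%:R|) <= spread * gauss th c.
Proof.
move=> cm peak.
apply: (@le_trans _ _ (\sum_(k < m.+1) gauss th c * expR 4 * 2^-1 ^+ ndist k c)).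
  by apply: ler_sum => k _; apply: gauss_decay peak; rewrite // -ltnS.
rewrite -mulr_sumr /spread.
have -> : 3 * expR 4 * gauss th c = gauss th c * expR 4 * 3 by ring.
by rewrite ler_wpM2l ?sum_half_ndist// mulr_ge0 ?expR_ge0// ltW// gauss_gt0.
Qed.

Lemma gauss_sum_le_peak th m c : (c <= m)%N ->
  (forall l, (l <= m)%N -> gauss th l <= gauss th c) ->
  gauss_sum m th <= spread * gauss th c.
Proof.
move=> cm peak; apply: le_trans (gauss_concentrated cm peak).
apply: ler_sum => k _; rewrite ler_peMr ?(ltW (gauss_gt0 _ _))//.
by rewrite -[leLHS]expR0 ler_expR mulr_ge0.
Qed.

Lemma gauss_peak th m : exists2 c, (c <= m)%N &
  forall l, (l <= m)%N -> gauss th l <= gauss th c.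
Proof.
have := @Order.TotalTheory.arg_maxP _ _ 'I_m.+1 ord0 xpredT (fun k : 'I_m.+1 =>
  gauss th k) isT.
case=> c _ hc; exists c; first by rewrite -ltnS.
by move=> l lm; have lm' : (l < m.+1)%N by []; exact: (hc (Ordinal lm')).
Qed.

Lemma sum_eighth m : \sum_(k < m) 8^-1 ^+ k.+1 <= 6^-1 :> R.
Proof.
apply: (@le_trans _ _ (7^-1 - 7^-1 * 8^-1 ^+ m)); last first.
  have : 0 <= 8^-1 ^+ m :> R by exact: exprn_ge0.
  by set x := 8^-1 ^+ m; lra.
elim: m => [|m IH]; first by rewrite big_ord0 expr0 mulr1 subrr.
by rewrite big_ord_recr /= !exprS; move: IH; set x := 8^-1 ^+ m; lra.
Qed.

(** The terms are at most powers of one eighth, summing to at most one seventh, against the term 1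
    at the origin. *)
Lemma gauss_mass_bot m : \sum_(k < m.+1 | (k : nat) != 0%N) gauss 0 k <= 6^-1 *
  gauss_sum m 0.
Proof.
rewrite big_mkcond big_ord_recl /= add0r.
apply: (@le_trans _ _ 6^-1); last first.
  rewrite ler_peMr// (le_trans _ (le_gauss_sum 0 (leq0n m)))//.
  by rewrite /gauss mul0r expr2 mul0r mulr0 subrr expR0.
apply: le_trans (sum_eighth m); apply: ler_sum => k _; rewrite /bump /= add1n /=.
apply: le_trans (expRN3_le _); rewrite /gauss ler_expR mul0r sub0r lerN2.
by rewrite ler_wpM2l// expr2 ler_peMl// ler1n.
Qed.

(** Mirror image of the previous bound: for [th >= 6 * m] the ratio of the term at [k] to that at
    [m] is at most [expR (- 3 (m - k) ^+ 2)]. *)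
Lemma gauss_mass_top m th : 6 * m%:R <= th ->
  \sum_(k < m.+1 | (k : nat) != m) gauss th k <= 6^-1 * gauss_sum m th.
Proof.
move=> hth; rewrite big_mkcond big_ord_recr /= eqxx addr0.
apply: (@le_trans _ _ (gauss th m * 6^-1)); last first.
  by rewrite mulrC ler_wpM2l// le_gauss_sum.
apply: (@le_trans _ _ (\sum_(k < m) gauss th m * 8^-1 ^+ k.+1)); last first.
  by rewrite -mulr_sumr ler_wpM2l ?sum_eighth// ltW// gauss_gt0.
rewrite [leRHS](reindex_inj rev_ord_inj) /=; apply: ler_sum => k _.
have km := ltn_ord k; rewrite (ltn_eqF km) subnSK//.
apply: le_trans (ler_wpM2l (ltW (gauss_gt0 _ _)) (expRN3_le _)).
rewrite /gauss -expRD ler_expR natrB ?(ltnW km)//.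
have : 1 <= m%:R - k%:R :> R by rewrite lerBrDl natr1 ler_nat.
have : 0 <= k%:R :> R by [].
set K := k%:R; set M := m%:R in hth * => K0 KM.
have : 6 * M * (M - K) <= th * (M - K) by rewrite ler_wpM2r//; lra.
rewrite !expr2; nra.
Qed.

End Gaussian.

(** * Hard instances *)

Section Families.
Context {R : realType} {n : R}.
Variables (q eps delta gamma : R).
Hypothesis eps_gt0 : 0 < eps.
Hypothesis eps_le : eps <= 100^-1.
Hypothesis delta_gt0 : 0 < delta.
Hypothesis gamma_gt0 : 0 < gamma.
Hypothesis gamma_le : gamma <= 16^-1.

Section Grid.
Variables (T : finType) (pos : T -> nat) (x0 h : R).
Hypothesis pos_inj : injective pos.
Hypothesis h_gt0 : 0 < h.

(** Origin 0 and step 1 give the integer instances. Origin 1 and a small step pack the points into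
    an interval of length 1, so that their number is not limited by [n]. *)
Definition grid (t : T) : R := x0 + h * (pos t)%:R.

Lemma grid_inj : injective grid.
Proof.
move=> s t /addrI /(mulfI (lt0r_neq0 h_gt0)) /eqP.
by rewrite eqr_nat => /eqP /pos_inj.
Qed.

Lemma exists_grid_instance (wt : T -> R) (t1 : T) (xmax B0 : R) :
  (forall t, ground n (grid t)) -> (forall t, 0 < wt t) ->
  (forall t, 0 <= grid t <= xmax) -> 0 < grid t1 -> 0 < B0 -> B0 * xmax <= q ->
  exists (I : instance n) (B : R),
    [/\ B0 <= B, presents grid I wt B & log_ratio I = q].
Proof.
move=> gr wt0 gx gt1 B00 Bq.
have [B BB Bq'] := exists_temperature wt0 gx gt1 (ltW B00) Bq.
have [I IP] := exists_instance grid_inj gr t1 wt0 (lt_le_trans B00 BB).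
by exists I, B; split; rewrite ?(log_ratio_presents grid_inj wt0 IP).
Qed.

Lemma grid_integer_setting (I : instance n) wt B : x0 = 0 -> h = 1 -> n \is a
  Num.int ->
  (forall t, (pos t)%:R <= n) -> presents grid I wt B -> integer_setting I.
Proof.
move=> x00 h1 nint pn [cI _ _]; split=> // x hx; rewrite cI atoms_eq0// => t tx.
by apply: hx; exists (pos t); rewrite // -tx /grid x00 h1 add0r mul1r.
Qed.

End Grid.

(** * The discrete Gaussian instance *)

Section GaussianInstance.
Variables (m : nat) (x0 h : R).
Hypothesis m_gt0 : (0 < m)%N.
Hypothesis h_gt0 : 0 < h.
Hypothesis x0_ge0 : 0 <= x0.

Definition gauss_pos (k : 'I_m.+1) : nat := k.

Definition gauss_wt (k : 'I_m.+1) : R := expR (- (3 * k%:R ^+ 2)).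

Local Notation gauss_pt := (grid gauss_pos x0 h).

Lemma gauss_pos_inj : injective gauss_pos. Proof. exact: val_inj. Qed.

Lemma gauss_wt_gt0 k : 0 < gauss_wt k. Proof. exact: expR_gt0. Qed.

(** The origin [x0] contributes only a common factor, which normalization removes; temperature acts
    through the slope [h * b]. *)
Lemma gauss_wt_expR b k : gauss_wt k * expR (b * gauss_pt k) = expR (b * x0) *
  gauss (h * b) k.
Proof. by rewrite /gauss_wt /gauss -!expRD; congr expR; rewrite /grid; ring. Qed.

Lemma mu_gauss b k : mu gauss_pt gauss_wt b k = gauss (h * b) k / gauss_sum m (h
  * b).
Proof.
rewrite /mu gauss_wt_expR /partsum.
under eq_bigr do rewrite gauss_wt_expR.
rewrite -mulr_sumr -/(gauss_sum m (h * b)); field.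
by rewrite !gt_eqF ?gauss_sum_gt0 ?expR_gt0.
Qed.

Lemma gauss_mu_concentrated b : exists c,
  expect gauss_pt gauss_wt b (fun k => expR (3 * `|(gauss_pos k)%:R - c|)) <=
    spread.
Proof.
have [c cm peak] := gauss_peak (h * b) m; exists c%:R.
rewrite /expect; under eq_bigr do rewrite mu_gauss mulrAC.
rewrite -mulr_suml ler_pdivrMr ?gauss_sum_gt0//.
apply: le_trans (gauss_concentrated cm peak) _.
by rewrite ler_wpM2l ?le_gauss_sum// mulr_ge0 ?expR_ge0.
Qed.

Lemma mu_mass b (P : pred 'I_m.+1) :
  \sum_(k < m.+1 | P k) gauss (h * b) k <= 6^-1 * gauss_sum m (h * b) ->
  \sum_(k | P k) mu gauss_pt gauss_wt b k <= 6^-1.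
Proof.
move=> hP; under eq_bigr do rewrite mu_gauss.
by rewrite -mulr_suml ler_pdivrMr ?gauss_sum_gt0.
Qed.

Lemma spread_gt0 : 0 < spread :> R.
Proof. by rewrite mulr_gt0 ?expR_gt0. Qed.

Definition cost_gauss := m%:R ^+ 2 * ln (1 / gamma) / (1152 * spread * eps ^+ 2).

(** The condition on [q] is [B0 * xmax <= q] for [B0 = 6 * m / h] and the last point
    [xmax = x0 + h * m]. From [B0] on the slope is at least [6 * m], so the mass has moved to the
    top. *)
Lemma gaussian_instance :
  (forall k, ground n (gauss_pt k)) -> 6 * m%:R * x0 / h + 6 * m%:R ^+ 2 <= q ->
  exists (I : instance n) (B : R),
  [/\ presents gauss_pt I gauss_wt B, log_ratio I = q,
      requires_cost (P_ratio eps) gamma I cost_gauss &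
      delta <= 2^-1 ->
      requires_cost (Pt_count delta eps) gamma I cost_gauss /\
      requires_cost (P_count delta eps) gamma I cost_gauss].
Proof.
move=> gr hq.
have m0 : 0 < m%:R :> R by rewrite ltr0n.
have gx k : 0 <= gauss_pt k <= x0 + h * m%:R.
  have hk : 0 <= h * (gauss_pos k)%:R by rewrite mulr_ge0// ltW.
  by rewrite /grid addr_ge0//= lerD2l ler_pM2l// ler_nat -ltnS /gauss_pos.
have gtop : 0 < gauss_pt ord_max by rewrite /grid ltr_wpDl// mulr_gt0.
have [||I [B [BB IP lr]]] := @exists_grid_instance _ gauss_pos x0 h
  gauss_pos_inj h_gt0 gauss_wt
    ord_max (x0 + h * m%:R) (6 * m%:R / h) gr gauss_wt_gt0 gx gtop.
- by rewrite divr_gt0// mulr_gt0.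
- rewrite (le_trans _ hq)// le_eqVlt; apply/orP; left; apply/eqP.
  by field; rewrite gt_eqF.
have hB : 6 * m%:R <= h * B by rewrite [h * B]mulrC -ler_pdivrMr.
have mass0 : \sum_(k | (gauss_pos k)%:R != 0 :> R) mu gauss_pt gauss_wt 0 k <= 6^-1.
  apply: mu_mass; rewrite mulr0 (eq_bigl (fun k : 'I_m.+1 => (k : nat) != 0%N)).
    exact: gauss_mass_bot.
  by move=> k; rewrite pnatr_eq0.
have massB : \sum_(k | (gauss_pos k)%:R != m%:R :> R) mu gauss_pt gauss_wt B k
  <= 6^-1.
  apply: mu_mass; rewrite (eq_bigl (fun k : 'I_m.+1 => (k : nat) != m)).
    exact: gauss_mass_top.
  by move=> k; rewrite eqr_nat.
have m1 : 1 <= m%:R :> R by rewrite ler1n.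
have kr (k : 'I_m.+1) : 0 <= ((gauss_pos k)%:R : R) <= m%:R by rewrite ler0n
  ler_nat -ltnS /gauss_pos ltn_ord.
have kb (k : 'I_m.+1) : (gauss_pos k)%:R = 0 :> R -> k = ord0.
  by move=> /eqP; rewrite pnatr_eq0 => /eqP k0; apply/val_inj.
have kt (k : 'I_m.+1) : (gauss_pos k)%:R = m%:R :> R -> k = ord_max.
  by move=> /eqP; rewrite eqr_nat => /eqP k0; apply/val_inj.
have gi := grid_inj (x0 := x0) gauss_pos_inj h_gt0.
exists I, B; split=> //.
  exact: (P_ratio_tilt gi gr ord0 gauss_wt_gt0 eps_gt0 eps_le gamma_gt0 gamma_le IP
    (k := fun k => (gauss_pos k)%:R) (tt := ord_max) m1 spread_gt0 kr erefl
      mass0 massB gauss_mu_concentrated).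
move=> d2; split.
  exact: (Pt_count_tilt gi gr ord0 gauss_wt_gt0 eps_gt0 eps_le gamma_gt0 gamma_le IP
    (k := fun k => (gauss_pos k)%:R) (tb := ord0) (tt := ord_max) m1 spread_gt0
      erefl erefl d2 mass0 massB gauss_mu_concentrated kb kt).
exact: (P_count_tilt gi gr ord0 gauss_wt_gt0 eps_gt0 eps_le delta_gt0 gamma_gt0
  gamma_le IP
    (k := fun k => (gauss_pos k)%:R) (tt := ord_max) m1 spread_gt0 kr erefl d2
      mass0 massB gauss_mu_concentrated kt).
Qed.

End GaussianInstance.
End Families.

Section LightFamilies.
Context {R : realType} {n : R}.
Variables (q eps delta gamma : R).
Hypothesis eps_gt0 : 0 < eps.
Hypothesis eps_le : eps <= 100^-1.
Hypothesis delta_gt0 : 0 < delta.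
Hypothesis gamma_gt0 : 0 < gamma.
Hypothesis gamma_le : gamma <= 16^-1.

(** * Light atoms between the atoms of a discrete Gaussian *)

Section CombInstance.
Variables (m : nat) (x0 h : R).
Hypothesis m_gt0 : (0 < m)%N.
Hypothesis h_gt0 : 0 < h.
Hypothesis x0_ge0 : 0 <= x0.
Hypothesis delta_le : delta <= (12 * spread)^-1.

(** Where a light atom balances its neighbours, the total weight is at most [2 * spread] times
    theirs, so this factor makes its probability at least [delta]. *)
Let a : R := 2 * spread * delta.

Let a_gt0 : 0 < a.
Proof. by rewrite !mulr_gt0 ?spread_gt0. Qed.

Let a_le : a <= 6^-1.
Proof.
have s0 := @spread_gt0 R.
have : 2 * spread * delta <= 2 * spread * (12 * spread)^-1.
  by rewrite ler_pM2l// mulr_gt0.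
have -> : 2 * spread * (12 * spread)^-1 = 6^-1 :> R by field; rewrite gt_eqF.
by [].
Qed.

Definition comb_pos (t : 'I_m.+1 + 'I_m) : nat :=
  match t with inl k => k.*2 | inr i => i.*2.+1 end.

(* The light weights, at odd positions, are [c] times the geometric mean of the
   two neighbouring heavy ones: AM-GM then bounds their total mass. *)
Definition comb_wt (c : R) (t : 'I_m.+1 + 'I_m) : R :=
  match t with
  | inl k => expR (- (3 * k%:R ^+ 2))
  | inr i => c * expR (- (3 * i%:R ^+ 2 + 3 * i.+1%:R ^+ 2) / 2)
  end.

Local Notation comb_pt := (grid comb_pos x0 h).

Lemma comb_pos_inj : injective comb_pos.
Proof.
move=> [k|i] [l|j] /= e; first by congr inl; apply/val_inj/double_inj.
- by have := congr1 odd e; rewrite /= !odd_double.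
- by have := congr1 odd e; rewrite /= !odd_double.
- by congr inr; apply/val_inj/double_inj; case: e.
Qed.

Lemma comb_wt_gt0 c t : 0 < c -> 0 < comb_wt c t.
Proof. by case: t => [k|i] c0 /=; rewrite ?mulr_gt0 ?expR_gt0. Qed.

(** The geometric mean of [gauss th i] and [gauss th i.+1]. *)
Definition geo (th : R) (i : nat) : R :=
  expR ((th * i%:R - 3 * i%:R ^+ 2 + (th * i.+1%:R - 3 * i.+1%:R ^+ 2)) / 2).

Lemma geo_le th i : geo th i <= (gauss th i + gauss th i.+1) / 2.
Proof.
rewrite /geo /gauss; set x := _ - _; set y := _ - _.
have -> : expR ((x + y) / 2) = expR (x / 2) * expR (y / 2).
  by rewrite -expRD mulrDl.
have e (z : R) : expR z = expR (z / 2) ^+ 2.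
  by rewrite expr2 -expRD; congr expR; lra.
rewrite (e x) (e y); have := sqr_ge0 (expR (x / 2) - expR (y / 2)).
by rewrite !expr2; set u := expR _; set v := expR _; nra.
Qed.

Lemma sum_geo_le th : \sum_(i < m) geo th i <= gauss_sum m th.
Proof.
apply: (@le_trans _ _ (\sum_(i < m) (gauss th i + gauss th i.+1) / 2)).
  by apply: ler_sum => i _; exact: geo_le.
rewrite -mulr_suml big_split /=.
have s1 : \sum_(i < m) gauss th i <= gauss_sum m th.
  by rewrite /gauss_sum big_ord_recr /= lerDl ltW// gauss_gt0.
have s2 : \sum_(i < m) gauss th i.+1 <= gauss_sum m th.
  rewrite /gauss_sum big_ord_recl /= lerDr; exact: ltW (gauss_gt0 _ _).
by lra.
Qed.

Lemma comb_wt_heavy c b k : comb_wt c (inl k) * expR (b * comb_pt (inl k)) =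
  expR (b * x0) * gauss (2 * h * b) k.
Proof.
by rewrite /gauss /= -!expRD; congr expR; rewrite /grid /= -muln2 natrM; ring.
Qed.

Lemma comb_wt_light c b i : comb_wt c (inr i) * expR (b * comb_pt (inr i)) =
  expR (b * x0) * (c * geo (2 * h * b) i).
Proof.
rewrite /= -mulrA [RHS]mulrCA; congr (_ * _); rewrite /geo -!expRD; congr expR.
by rewrite /grid /= -!natr1 -muln2 natrM; field.
Qed.

Lemma partsum_comb b : partsum comb_pt (comb_wt a) b =
  expR (b * x0) * (gauss_sum m (2 * h * b) + a * \sum_(i < m) geo (2 * h * b) i).
Proof.
rewrite /partsum big_sumType /= mulrDr /gauss_sum !mulr_sumr.
by congr (_ + _); apply: eq_bigr => k _; rewrite (comb_wt_heavy, comb_wt_light).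
Qed.

Let total_gt0 th : 0 < gauss_sum m th + a * \sum_(i < m) geo th i.
Proof.
rewrite ltr_pwDl ?gauss_sum_gt0// mulr_ge0 ?(ltW a_gt0)//.
by apply: sumr_ge0 => i _; exact: expR_ge0.
Qed.

Lemma mu_light b i : mu comb_pt (comb_wt a) b (inr i) =
  a * geo (2 * h * b) i /
  (gauss_sum m (2 * h * b) + a * \sum_(j < m) geo (2 * h * b) j).
Proof.
rewrite /mu partsum_comb.
by rewrite [X in X / _](comb_wt_light a b i) -mulf_div divff ?mul1r ?gt_eqF
  ?expR_gt0.
Qed.

Lemma mu_heavy b k : mu comb_pt (comb_wt a) b (inl k) =
  gauss (2 * h * b) k /
  (gauss_sum m (2 * h * b) + a * \sum_(j < m) geo (2 * h * b) j).
Proof.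
rewrite /mu partsum_comb.
by rewrite [X in X / _](comb_wt_heavy a b k) -mulf_div divff ?mul1r ?gt_eqF
  ?expR_gt0.
Qed.

Let total_le th (c : nat) : (c <= m)%N ->
  (forall l, (l <= m)%N -> gauss th l <= gauss th c) ->
  gauss_sum m th + a * \sum_(i < m) geo th i <= 2 * spread * gauss th c.
Proof.
move=> cm peak; have := gauss_sum_le_peak cm peak; have := sum_geo_le th.
have s0 : 0 <= \sum_(i < m) geo th i by apply: sumr_ge0 => i _; exact: expR_ge0.
have := a_le; have := a_gt0.
set S := gauss_sum _ _; set G := \sum_(_ < _) _ in s0 *; nra.
Qed.

Lemma sum_mu_light b : \sum_i mu comb_pt (comb_wt a) b (inr i) <= a.
Proof.
under eq_bigr do rewrite mu_light.
rewrite -mulr_suml -mulr_sumr ler_pdivrMr// ler_pM2l//.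
rewrite (le_trans (sum_geo_le _))// lerDl mulr_ge0 ?(ltW a_gt0)//.
by apply: sumr_ge0 => i _; exact: expR_ge0.
Qed.

(** Here the slope [2 * h * b] equals [3 * (2 * i + 1)]: the Gaussian peaks equally at [i] and
    [i + 1], and their geometric mean equals both. *)
Definition visible_at (i : 'I_m) : R := 3 * (2 * i%:R + 1) / (2 * h).

Lemma light_visible i : delta <= mu comb_pt (comb_wt a) (visible_at i) (inr i).
Proof.
rewrite mu_light.
have -> : 2 * h * visible_at i = 3 * (2 * i%:R + 1).
  by rewrite /visible_at; field; rewrite gt_eqF.
set th := 3 * _.
have geoE : geo th i = gauss th i.
  by rewrite /geo /gauss; congr expR; rewrite /th -natr1; field.
have im : (i <= m)%N by exact: ltnW.
have peak l : (l <= m)%N -> gauss th l <= gauss th i.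
  move=> _; rewrite /gauss ler_expR /th.
  (* The real maximum of the exponent is at [i + 1/2], so integrality of [l] is used. *)
  have [li|il] := leqP l i.
    have : l%:R <= i%:R :> R by rewrite ler_nat.
    set L := l%:R; set I := i%:R => ?; rewrite !expr2; nra.
  have : i%:R + 1 <= l%:R :> R by rewrite natr1 ler_nat.
  set L := l%:R; set I := i%:R => ?; rewrite !expr2; nra.
rewrite ler_pdivlMr ?total_gt0// geoE.
apply: le_trans (ler_wpM2l (ltW delta_gt0) (total_le im peak)) _.
by rewrite /a le_eqVlt; apply/orP; left; apply/eqP; ring.
Qed.

Lemma heavy_visible : delta <= mu comb_pt (comb_wt a) 0 (inl ord0).
Proof.
rewrite mu_heavy mulr0.
have peak l : (l <= m)%N -> gauss (0 : R) l <= gauss 0 0%N.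
  by move=> _; rewrite /gauss ler_expR !mul0r !sub0r lerN2 [0%:R ^+ 2]expr2
    mul0r mulr0 mulr_ge0// sqr_ge0.
rewrite ler_pdivlMr ?total_gt0//.
apply: le_trans (ler_wpM2l (ltW delta_gt0) (total_le (leq0n m) peak)) _.
rewrite mulrA [delta * _]mulrC -/a ler_piMl ?(ltW (gauss_gt0 _ _))//.
by apply: le_trans a_le _; rewrite invf_le1// ler1n.
Qed.

Definition cost_comb := m%:R * ln (1 / gamma) / (4608 * spread * delta * eps ^+ 2).

(** Every [visible_at i] is below [B0 = 3 * m / h]; multiplied by the last point [x0 + 2 * h * m],
    this gives the condition on [q]. *)
Lemma comb_instance :
  (forall t, ground n (comb_pt t)) -> 3 * m%:R * x0 / h + 6 * m%:R ^+ 2 <= q ->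
  exists (I : instance n) (B : R),
  [/\ presents comb_pt I (comb_wt a) B, log_ratio I = q,
      requires_cost (Pt_count delta eps) gamma I cost_comb &
      requires_cost (P_count delta eps) gamma I cost_comb].
Proof.
move=> gr hq.
have m0 : 0 < m%:R :> R by rewrite ltr0n.
have wt0 t : 0 < comb_wt a t by exact: comb_wt_gt0.
have gx t : 0 <= comb_pt t <= x0 + h * m.*2%:R.
  have ht : 0 <= h * (comb_pos t)%:R by rewrite mulr_ge0// ltW.
  rewrite /grid addr_ge0//= lerD2l ler_pM2l// ler_nat.
  case: t {ht} => [k|i] /=; first by rewrite leq_double -ltnS.
  by rewrite ltn_double.
have gtop : 0 < comb_pt (inl ord_max).
  by rewrite /grid ltr_wpDl// mulr_gt0// ltr0n double_gt0.
have [||I [B [BB IP lr]]] := @exists_grid_instance _ n q _ comb_pos x0 h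
  comb_pos_inj h_gt0 (comb_wt a)
    (inl ord_max) (x0 + h * m.*2%:R) (3 * m%:R / h) gr wt0 gx gtop.
- by rewrite divr_gt0// mulr_gt0.
- rewrite (le_trans _ hq)// le_eqVlt; apply/orP; left; apply/eqP.
  by rewrite -muln2 natrM; field; rewrite gt_eqF.
have bl i : 0 <= visible_at i <= B.
  apply/andP; split; first by rewrite divr_ge0 ?mulr_ge0 ?addr_ge0 ?mulr_ge0// ltW.
  apply: le_trans BB; rewrite /visible_at invfM mulrA ler_pM2r ?invr_gt0//.
  have : i%:R + 1 <= m%:R :> R by rewrite natr1 ler_nat.
  by set J := i%:R; set M := m%:R; lra.
have B0 : 0 <= (0 : R) <= B.
  by rewrite lexx (le_trans _ BB)// divr_ge0 ?mulr_ge0// ltW.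
have gi := grid_inj (x0 := x0) comb_pos_inj h_gt0.
have J0 : (0 < #|'I_m|)%N by rewrite card_ord.
have costE : cost_comb =
    #|'I_m|%:R * ln (1 / gamma) / (2304 * a * eps ^+ 2).
  by rewrite card_ord /cost_comb /a; congr (_ / _); ring.
have sl b : 0 <= b <= B -> \sum_i mu comb_pt (comb_wt a) b (inr i) <= a.
  by move=> _; exact: sum_mu_light.
exists I, B; split=> //; rewrite costE.
  exact: (Pt_count_light gi gr (inl ord0) wt0 eps_gt0 eps_le gamma_gt0 gamma_le IP
    J0 a_gt0 sl bl light_visible B0 heavy_visible).
exact: (P_count_light gi gr (inl ord0) wt0 eps_gt0 eps_le delta_gt0 gamma_gt0
  gamma_le IP
    J0 a_gt0 a_le sl bl light_visible).
Qed.

End CombInstance.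

(** * A light and a heavy atom *)

Section TwoPoints.
Hypothesis delta_le : delta <= 6^-1.
Hypothesis n_ge1 : 1 <= n.
Hypothesis q_ge1 : 1 <= q.

Definition two_pos (t : bool) : nat := ~~ t.
(** The light atom sits at 0 and the heavy one at 1, so raising [b] only lowers the light
    probability from its initial value [delta]. *)
Definition two_wt (t : bool) : R := if t then delta else 1 - delta.

Local Notation two_pt := (grid two_pos (0 : R) 1).

Lemma two_pos_inj : injective two_pos. Proof. by do 2!case. Qed.

Let two_wt_gt0 t : 0 < two_wt t.
Proof. by case: t => //=; have := delta_le; lra. Qed.

Let two_ptE (t : bool) : two_pt t = (~~ t)%:R :> R.
Proof. by rewrite /grid add0r mul1r. Qed.

Definition cost_two_points := ln (1 / gamma) / (2304 * delta * eps ^+ 2).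

Lemma two_points_instance : exists (I : instance n) (B : R),
  [/\ presents two_pt I two_wt B, log_ratio I = q,
      requires_cost (Pt_count delta eps) gamma I cost_two_points &
      requires_cost (P_count delta eps) gamma I cost_two_points].
Proof.
have gr t : ground n (two_pt t).
  rewrite two_ptE; case: t => /=; [by left|right].
  by rewrite /= in_itv /= lexx.
have gx t : 0 <= two_pt t <= 1 by rewrite two_ptE; case: t; rewrite /= ?lexx ?ler01.
have gi := @grid_inj R _ two_pos 0 1 two_pos_inj ltr01.
have [|||I [B [BB IP lr]]] := @exists_grid_instance _ n q _ two_pos 0 1
  two_pos_inj ltr01 two_wt
    false 1 1 gr two_wt_gt0 gx.
- by rewrite two_ptE.
- by [].
- by rewrite mulr1.
have B0 : 0 <= (0 : R) <= B by rewrite lexx (le_trans _ BB).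
have psE b : partsum two_pt two_wt b = delta + (1 - delta) * expR b.
  by rewrite /partsum big_bool !two_ptE /= mulr0 mulr1 expR0 mulr1.
have ps0 : partsum two_pt two_wt 0 = 1 by rewrite psE expR0; lra.
have sl b : 0 <= b <= B -> \sum_(j : unit) mu two_pt two_wt b true <= delta.
  move=> /andP[b0 _]; rewrite big_const card_unit /= addr0 /mu psE two_ptE /=
    mulr0 expR0 mulr1.
  have eb : 1 <= expR b by rewrite -expR0 ler_expR.
  have d6 := delta_le; have d0 := delta_gt0.
  have : 0 <= (1 - delta) * (expR b - 1) by apply: mulr_ge0; lra.
  move: eb; set e := expR b => eb ed.
  rewrite ler_pdivrMr; last by lra.
  by rewrite ler_peMr//; lra.
have vis : delta <= mu two_pt two_wt 0 true.
  by rewrite /mu ps0 two_ptE /= mulr0 expR0 mulr1 divr1.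
have hvis : delta <= mu two_pt two_wt 0 false.
  by rewrite /mu ps0 two_ptE /= mulr1 expR0 mulr1 divr1; have := delta_le; lra.
have costE : cost_two_points =
    #|{: unit}|%:R * ln (1 / gamma) / (2304 * delta * eps ^+ 2).
  by rewrite card_unit (mul1r (ln (1 / gamma))).
have J0 : (0 < #|{: unit}|)%N by rewrite card_unit.
exists I, B; split=> //; rewrite costE.
  exact: (Pt_count_light gi gr true two_wt_gt0 eps_gt0 eps_le gamma_gt0 gamma_le IP
    (light := fun=> true) (bl := fun=> 0) (y := false)
    J0 delta_gt0 sl (fun=> B0) (fun=> vis) B0 hvis).
exact: (P_count_light gi gr true two_wt_gt0 eps_gt0 eps_le delta_gt0 gamma_gt0
  gamma_le IP
    (light := fun=> true) (bl := fun=> 0)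
    J0 delta_gt0 delta_le sl (fun=> B0) (fun=> vis)).
Qed.

End TwoPoints.
End LightFamilies.

(** * Log-concavity and comparison of costs *)

Lemma requires_cost_le (R : realType) (n : R) (Out : Type)
    (P : instance n -> set Out) (g : R) (I : instance n) (C C' : R) :
  C' <= C -> requires_cost P g I C -> requires_cost P g I C'.
Proof. by move=> CC h A sA; apply: le_trans (h A sA); rewrite lee_fin. Qed.

Section Assembly.
Context {R : realType} {n : R}.

Lemma ground_nat (j : nat) : j%:R <= n -> ground n j%:R.
Proof.
case: j => [|j] jn; [by left|right].
by rewrite /= in_itv /= jn ler1n.
Qed.

Lemma ground_shift (x : R) : 2 <= n -> 0 <= x <= 1 -> ground n (1 + x).
Proof. by move=> n2 /andP[x0 x1]; right; rewrite /= in_itv /=; apply/andP;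
  split; lra. Qed.

Lemma atoms_grid01 (T : finType) (pos : T -> nat) (wt : T -> R) t :
  injective pos -> atoms (grid pos 0 1) wt (pos t)%:R = wt t.
Proof.
move=> pinj; have <- : grid pos 0 1 t = (pos t)%:R :> R by rewrite /grid add0r
  mul1r.
exact: (atoms_pt (grid_inj (x0 := 0) pinj ltr01)).
Qed.

Lemma gaussian_log_concave (I : instance n) (m : nat) B :
  n \is a Num.int -> m%:R <= n ->
  presents (grid (@gauss_pos m) 0 1) I (@gauss_wt R m) B -> log_concave I.
Proof.
move=> nint mn IP; split.
  apply: (grid_integer_setting (pos := @gauss_pos m) erefl erefl nint _ IP) => k.
  by apply: le_trans mn; rewrite ler_nat -ltnS ltn_ord.
have [cI _ _] := IP.
have cE k : (k <= m)%N -> Defs.count I k%:R = expR (- (3 * k%:R ^+ 2)).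
  move=> km; have km' : (k < m.+1)%N by [].
  by rewrite cI -[k]/(gauss_pos (Ordinal km')) (atoms_grid01 (@gauss_wt R m) _
    (@gauss_pos_inj m)).
have c0 k : Defs.count I k%:R != 0 -> (k <= m)%N.
  rewrite cI => /atoms_neq0[t]; rewrite /grid add0r mul1r => /eqP.
  by rewrite eqr_nat => /eqP ->; rewrite -ltnS ltn_ord.
exists 0%N, m; split=> k.
  by split=> [/c0//|/andP[_ km]]; rewrite cE// gt_eqF// expR_gt0.
case: k => // k /andP[_ km]; rewrite !cE ?(ltnW km) ?(ltnW (ltnW km))//=.
rewrite -expRD [leRHS]expr2 -expRD ler_expR -[k.+2%:R]natr1 -[k.+1%:R]natr1 !expr2.
by set x := k%:R; lra.
Qed.

Lemma two_points_log_concave (I : instance n) (delta : R) B :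
  0 < delta -> delta < 1 -> n \is a Num.int -> 1 <= n ->
  presents (grid two_pos 0 1) I (two_wt delta) B -> log_concave I.
Proof.
move=> d0 d1 nint n1 IP; split.
  apply: (grid_integer_setting (pos := two_pos) erefl erefl nint _ IP) => t.
  by case: t => //=; rewrite (le_trans _ n1).
have [cI _ _] := IP.
exists 0%N, 1%N; split=> k; last by case: k => [|[|k]].
rewrite cI; split=> [/atoms_neq0[t]|].
  rewrite /grid add0r mul1r => /eqP; rewrite eqr_nat => /eqP ->; by case: t.
case: k => [|[|k]] // _.
  by rewrite (atoms_grid01 (two_wt delta) true two_pos_inj) gt_eqF.
by rewrite (atoms_grid01 (two_wt delta) false two_pos_inj) gt_eqF//= subr_gt0.
Qed.

End Assembly.

Lemma exists_halving (R : realType) (x : R) : 1 <= x ->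
  exists m : nat, [/\ (0 < m)%N, m%:R <= x & x <= 2 * m%:R].
Proof.
move=> x1; exists (Num.truncn x).
have m1 : (0 < Num.truncn x)%N by rewrite truncn_gt0.
have /andP[h1 h2] := truncn_itv (le_trans ler01 x1).
split=> //; rewrite -natr1 in h2.
have : 1 <= (Num.truncn x)%:R :> R by rewrite ler1n.
by set M := _%:R in h2 *; lra.
Qed.

Section Costs.
Context {R : realType}.
Variables (eps delta gamma : R).
Hypothesis eps_gt0 : 0 < eps.
Hypothesis delta_gt0 : 0 < delta.
Hypothesis gamma_gt0 : 0 < gamma.
Hypothesis gamma_le1 : gamma <= 1.

(** The number [200 * 1000] exceeds [128 * 1152], [16 * 4608] and [2 * 2304], which arise from the
    three kinds of instances. *)
Let K : R := (200 * 1000 * spread)^-1.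
Let cost D := K * (D * ln (1 / gamma) / eps ^+ 2).

Lemma spread_ge1 : 1 <= spread :> R.
Proof.
have : 1 <= expR 4 :> R by rewrite -expR0 ler_expR.
by rewrite /spread; set e := expR 4; lra.
Qed.

Let cost_le D X : D / (200 * 1000) <= X ->
  cost D <= X / spread * (ln (1 / gamma) / eps ^+ 2).
Proof.
move=> DX; have s0 := lt_le_trans ltr01 spread_ge1.
have -> : cost D = D / (200 * 1000) / spread * (ln (1 / gamma) / eps ^+ 2).
  by rewrite /cost /K !invfM; ring.
apply: ler_wpM2r.
  by rewrite divr_ge0 ?sqr_ge0// ln_ge0// ler_pdivlMr// mul1r.
by rewrite ler_pM2r ?invr_gt0.
Qed.

Lemma cost_gauss_ge D (m : nat) : D <= 128 * m%:R ^+ 2 -> cost D <= cost_gauss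
  eps gamma m.
Proof.
move=> h; have s0 := lt_le_trans ltr01 spread_ge1.
have -> : cost_gauss eps gamma m =
    m%:R ^+ 2 / 1152 / spread * (ln (1 / gamma) / eps ^+ 2).
  by rewrite /cost_gauss; field; rewrite !gt_eqF.
by apply: cost_le; move: h; have := sqr_ge0 (m%:R : R); set x := _ ^+ 2; lra.
Qed.

Lemma cost_comb_ge D (m : nat) : D <= 16 * (m%:R / delta) ->
  cost D <= cost_comb eps delta gamma m.
Proof.
move=> h; have s0 := lt_le_trans ltr01 spread_ge1.
have -> : cost_comb eps delta gamma m =
    m%:R / delta / 4608 / spread * (ln (1 / gamma) / eps ^+ 2).
  by rewrite /cost_comb; field; rewrite !gt_eqF.
have x0 : 0 <= m%:R / delta by rewrite divr_ge0// ltW.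
by apply: cost_le; move: h x0; set x := m%:R / delta; lra.
Qed.

Lemma cost_two_points_ge D : D <= 2 / delta ->
  cost D <= cost_two_points eps delta gamma.
Proof.
move=> h; have s1 := spread_ge1; have s0 := lt_le_trans ltr01 s1.
have -> : cost_two_points eps delta gamma =
    delta^-1 * spread / 2304 / spread * (ln (1 / gamma) / eps ^+ 2).
  by rewrite /cost_two_points; field; rewrite !gt_eqF.
have d0 : 0 <= delta^-1 by rewrite invr_ge0 ltW.
have ds : delta^-1 <= delta^-1 * spread by rewrite ler_peMr.
apply: cost_le; move: h d0 ds; set x := delta^-1; set y := x * spread.
by lra.
Qed.

End Costs.

(** * Assembly of the five lower bounds *)

Theorem theorem57 (R : realType) :
  exists eps_max gamma_max delta_max q_min K : R,
  [/\ 0 < eps_max, 0 < gamma_max, 0 < delta_max & 0 < K] /\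
  forall n q eps gamma delta : R,
    2 <= n -> q_min <= q ->
    0 < eps -> eps < eps_max ->
    0 < gamma -> gamma < gamma_max ->
    0 < delta -> delta <= delta_max ->
    [/\ n \is a Num.int ->
        exists I : instance n,
          let C := K * (Num.min (q + Num.sqrt q / delta)
                                (n ^+ 2 + n / delta)
                        * ln (1 / gamma) / eps ^+ 2) in
          [/\ integer_setting I, log_ratio I = q,
              requires_cost (Pt_count delta eps) gamma I C &
              requires_cost (P_count delta eps) gamma I C],
        n \is a Num.int ->
        exists I : instance n,
          let C := K * ((1 / delta + Num.min q (n ^+ 2))
                        * ln (1 / gamma) / eps ^+ 2) in
          [/\ log_concave I, log_ratio I = q,
              requires_cost (Pt_count delta eps) gamma I C &
              requires_cost (P_count delta eps) gamma I C],
        n \is a Num.int ->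
        exists I : instance n,
          let C := K * (Num.min q (n ^+ 2) * ln (1 / gamma) / eps ^+ 2) in
          [/\ log_concave I, log_ratio I = q &
              requires_cost (P_ratio eps) gamma I C],
        exists I : instance n,
          let C := K * ((q + Num.sqrt q / delta)
                        * ln (1 / gamma) / eps ^+ 2) in
          [/\ log_ratio I = q,
              requires_cost (Pt_count delta eps) gamma I C &
              requires_cost (P_count delta eps) gamma I C] &
        exists I : instance n,
          let C := K * (q * ln (1 / gamma) / eps ^+ 2) in
          log_ratio I = q /\ requires_cost (P_ratio eps) gamma I C].
Proof.
have s1 := @spread_ge1 R; have s0 := lt_le_trans ltr01 s1.
(* The bound 16 on [q] gives [Num.sqrt q >= 4], so that the integer parts taken below are
   positive. *)
exists 100^-1, 16^-1, (12 * spread)^-1, 16, (200 * 1000 * spread)^-1.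
split.
  split; [by rewrite invr_gt0|by rewrite invr_gt0| |]; rewrite invr_gt0.
    exact: mulr_gt0.
  by apply: mulr_gt0; [apply: mulr_gt0; rewrite ltr0n|].
move=> n q eps gamma delta n2 q16 e0 /ltW e1 g0 /ltW g1 d0 d1.
have g11 : gamma <= 1 by lra.
have d12 : delta <= 12^-1.
  by apply: le_trans d1 _; rewrite lef_pV2 ?posrE//; [rewrite ler_peMr|exact:
    mulr_gt0].
have d2 : delta <= 2^-1 by lra.
have d6 : delta <= 6^-1 by lra.
have q0 : 0 <= q by lra.
have rq2 : Num.sqrt q ^+ 2 = q by rewrite sqr_sqrtr.
set r := Num.sqrt q in rq2 *.
have r0 : 0 <= r by exact: sqrtr_ge0.
have r4 : 4 <= r.
  by rewrite -(@ler_pXn2r _ 2) ?nnegrE// rq2 -natrX.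
(* A sum is at most twice its larger term, so an instance that is hard for the dominant term
   suffices. *)
have sum_cases (x : R) : 0 <= x -> x ^+ 2 + x / delta <= 2 * x ^+ 2 \/
    x ^+ 2 + x / delta <= 2 * (x / delta).
  by move=> _; case: (leP (x / delta) (x ^+ 2)) => h; [left|right]; lra.
(* Both arguments of the minimum in (a) are values of [x ^+ 2 + x / delta], at [r] and at [n]; the
   case distinction can thus be made at [M]. *)
pose M := Num.min r n.
have M0 : 0 <= M by rewrite le_min r0; lra.
have M2 : Num.min q (n ^+ 2) <= M ^+ 2.
  by rewrite /M; case: (leP r n) => _; rewrite ge_min ?rq2 lexx ?orbT.
have MD : Num.min (q + r / delta) (n ^+ 2 + n / delta) <= M ^+ 2 + M / delta.
  by rewrite /M; case: (leP r n) => _; rewrite ge_min ?rq2 lexx ?orbT.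
(* In the integer setting the comb occupies the positions up to [2 * m], hence [2 * m <= n]; [r / 3]
   ensures [6 * m ^+ 2 <= q]. *)
have [m [m0 mr mn mM]] : exists m : nat,
    [/\ (0 < m)%N, 6 * m%:R ^+ 2 <= q, 2 * m%:R <= n & M <= 8 * m%:R].
  have [|m [m0 mx xm]] := @exists_halving R (Num.min (r / 3) (n / 2)).
    by rewrite le_min; apply/andP; split; lra.
  move: mx; rewrite le_min => /andP[mr mn].
  have mm : 0 <= m%:R :> R by [].
  exists m; split=> //; last 2 first.
  - by lra.
  - apply: (@le_trans _ _ (3 * Num.min (r / 3) (n / 2))); last by lra.
    rewrite /M; case: (leP (r / 3) (n / 2)) => _; rewrite ge_min; apply/orP.
      by left; lra.
    by right; lra.
  by rewrite -rq2; set x := m%:R in mr mm *; rewrite !expr2; nra.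
have mm0 : 0 <= m%:R :> R by [].
have M64 : 2 * M ^+ 2 <= 128 * m%:R ^+ 2.
  by rewrite !expr2; set x := m%:R in mM mm0 *; nra.
have gauss_int : exists (I : instance n) (B : R),
  [/\ presents (grid (@gauss_pos m) 0 1) I (@gauss_wt R m) B, log_ratio I = q,
      requires_cost (P_ratio eps) gamma I (cost_gauss eps gamma m) &
      requires_cost (Pt_count delta eps) gamma I (cost_gauss eps gamma m) /\
      requires_cost (P_count delta eps) gamma I (cost_gauss eps gamma m)].
  have [||I [B [IP lr h1 h2]]] := @gaussian_instance R n q eps delta gamma e0 e1
    d0 g0 g1
      m 0 1 m0 ltr01 (lexx 0).
  - move=> k; rewrite /grid add0r mul1r; apply: ground_nat.
    apply: (@le_trans _ _ m%:R); first by rewrite ler_nat -ltnS ltn_ord.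
    by lra.
  - by rewrite mulr0 mul0r add0r.
  by exists I, B; split=> //; exact: h2.
have gauss_lc (I : instance n) B : n \is a Num.int ->
    presents (grid (@gauss_pos m) 0 1) I (@gauss_wt R m) B -> log_concave I.
  by move=> nint IP; apply: (gaussian_log_concave nint _ IP); lra.
(* On the packed grid, origin 1 with step [1 / l], or [1 / (2 * l)] for the comb, turns the
   condition on [q] into [12 * l ^+ 2 <= q]. *)
have [l [l0 lq rl]] : exists l : nat,
    [/\ (0 < l)%N, 12 * l%:R ^+ 2 <= q & r <= 8 * l%:R].
  have [|l [l0 lx xl]] := @exists_halving R (r / 4); first by lra.
  have ll : 0 <= l%:R :> R by [].
  exists l; split=> //; last by lra.
  by rewrite -rq2; set x := l%:R in lx ll *; rewrite !expr2; nra.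
have ll0 : 0 < l%:R :> R by rewrite ltr0n.
have r64 : 2 * r ^+ 2 <= 128 * l%:R ^+ 2.
  by rewrite !expr2; set x := l%:R in rl ll0 *; nra.
have gauss_gen : exists (I : instance n),
  [/\ log_ratio I = q,
      requires_cost (P_ratio eps) gamma I (cost_gauss eps gamma l) &
      requires_cost (Pt_count delta eps) gamma I (cost_gauss eps gamma l) /\
      requires_cost (P_count delta eps) gamma I (cost_gauss eps gamma l)].
  have [|||I [B [IP lr h1 h2]]] := @gaussian_instance R n q eps delta gamma e0
    e1 d0 g0 g1
      l 1 (l%:R^-1) l0 _ ler01.
  - by rewrite invr_gt0.
  - move=> k; apply: ground_shift => //; rewrite mulr_ge0 ?invr_ge0//=.
    by rewrite mulrC ler_pdivrMr// mul1r ler_nat -ltnS ltn_ord.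
  - apply: le_trans lq; rewrite le_eqVlt; apply/orP; left; apply/eqP.
    by field; rewrite gt_eqF.
  by exists I; split=> //; exact: h2.
split.
- move=> nint.
  have [h|h] := sum_cases M M0.
    have [I [B [IP lr _ [h1 h2]]]] := gauss_int.
    exists I; split=> //; first by have [] := gauss_lc I B nint IP.
      apply: requires_cost_le h1; apply: cost_gauss_ge => //.
      exact: le_trans (le_trans MD h) M64.
    apply: requires_cost_le h2; apply: cost_gauss_ge => //.
    exact: le_trans (le_trans MD h) M64.
  have [||I [B [IP lr h1 h2]]] := @comb_instance R n q eps delta gamma e0 e1 d0
    g0 g1
      m 0 1 m0 ltr01 (lexx 0) d1.
  + move=> t; rewrite /grid add0r mul1r; apply: ground_nat.
    apply: le_trans mn; rewrite -natrM ler_nat mul2n.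
    by case: t => [k|i] /=; [rewrite leq_double -ltnS|rewrite ltn_double].
  + by rewrite mulr0 mul0r add0r.
  have D : Num.min (q + r / delta) (n ^+ 2 + n / delta) <= 16 * (m%:R / delta).
    apply: le_trans (le_trans MD h) _; rewrite !mulrA ler_pM2r ?invr_gt0//; lra.
  exists I; split=> //.
  + apply: (grid_integer_setting (pos := @comb_pos m) erefl erefl nint _ IP) => t.
    apply: le_trans mn; rewrite -natrM ler_nat mul2n.
    by case: t => [k|i] /=; [rewrite leq_double -ltnS|rewrite ltn_double].
  + by apply: requires_cost_le h1; apply: cost_comb_ge.
  + by apply: requires_cost_le h2; apply: cost_comb_ge.
(* The Gaussian instance serves when [M ^+ 2] dominates, the two-point instance when [1 / delta]
   does; both are log-concave. *)
- move=> nint; have [h|/ltW h] := leP (1 / delta) (M ^+ 2).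
    have [I [B [IP lr _ [h1 h2]]]] := gauss_int.
    have D : 1 / delta + Num.min q (n ^+ 2) <= 128 * m%:R ^+ 2 by lra.
    exists I; split=> //; first exact: gauss_lc IP.
      by apply: requires_cost_le h1; apply: cost_gauss_ge.
    by apply: requires_cost_le h2; apply: cost_gauss_ge.
  have D : 1 / delta + Num.min q (n ^+ 2) <= 2 / delta.
    have -> : 2 / delta = 1 / delta + 1 / delta by rewrite -mulrDl.
    by lra.
  have [||I [B [IP lr h1 h2]]] := @two_points_instance R n q eps delta gamma e0
    e1 d0 g0 g1 d6.
  + by lra.
  + by lra.
  exists I; split=> //.
  + by apply: (two_points_log_concave d0 _ nint _ IP); lra.
  + by apply: requires_cost_le h1; apply: cost_two_points_ge.
  + by apply: requires_cost_le h2; apply: cost_two_points_ge.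
- move=> nint; have [I [B [IP lr h _]]] := gauss_int.
  exists I; split=> //; first exact: gauss_lc IP.
  apply: requires_cost_le h; apply: cost_gauss_ge => //.
  by have := sqr_ge0 M; lra.
- have [h|h] := sum_cases r r0.
    have [I [lr _ [h1 h2]]] := gauss_gen.
    have D : q + r / delta <= 128 * l%:R ^+ 2 by rewrite -rq2 (le_trans h).
    exists I; split=> //.
      by apply: requires_cost_le h1; apply: cost_gauss_ge.
    by apply: requires_cost_le h2; apply: cost_gauss_ge.
  have [|||I [B [IP lr h1 h2]]] := @comb_instance R n q eps delta gamma e0 e1 d0
    g0 g1
      l 1 ((2 * l%:R)^-1) l0 _ ler01 d1.
  + by rewrite invr_gt0 mulr_gt0.
  + move=> t; apply: ground_shift => //; rewrite mulr_ge0 ?invr_ge0 ?mulr_ge0//=.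
    rewrite mulrC ler_pdivrMr ?mulr_gt0// mul1r -natrM ler_nat mul2n.
    by case: t => [k|i] /=; [rewrite leq_double -ltnS|rewrite ltn_double].
  + apply: le_trans lq; rewrite le_eqVlt; apply/orP; left; apply/eqP.
    by field; rewrite gt_eqF.
  have D : q + r / delta <= 16 * (l%:R / delta).
    rewrite -rq2; apply: le_trans h _; rewrite !mulrA ler_pM2r ?invr_gt0//; lra.
  exists I; split=> //.
    by apply: requires_cost_le h1; apply: cost_comb_ge.
  by apply: requires_cost_le h2; apply: cost_comb_ge.
- have [I [lr h _]] := gauss_gen.
  exists I; split=> //; apply: requires_cost_le h; apply: cost_gauss_ge => //.
  by rewrite -rq2; have := sqr_ge0 r; lra.
Qed.
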